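(* Let $\mathcal C$ be a hereditary graph class. Suppose that, for every $q\in\mathbb N$, there exist $c_q\ge 1$ and $\eta_q\in(0,1]$ such that every $n$-vertex graph in $\mathcal C_{\le q}$ has a balanced separator of size at most $c_q n^{1-\eta_q}$. Then there exist constants $K\ge 1$, $\beta>0$, and an integer $s\ge 0$ such that, for every $G\in\mathcal C$, $$\mathsf{sep}(G)\le K\,\omega(G)^s\,|V(G)|^{1-\beta}.$$
   Context: All graphs are finite, simple and nonempty; $\mathbb N$ is the set of positive integers. A graph class is hereditary if it is closed under taking induced subgraphs. $\omega(G)$ is the clique number, and $\mathcal C_{\le q}=\{G\in\mathcal C:\omega(G)\le q\}$. A balanced separator of $G$ is a set $S\subseteq V(G)$ such that every connected component of $G-S$ has at most $2|V(G)|/3$ vertices; $\mathsf{sep}(G)$ is the minimum size of a balanced separator of $G$. *)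

(* Defs.v *)
From HB Require Import structures.
From mathcomp Require Import all_boot all_order all_algebra.
From mathcomp Require Import reals exp.

Set Implicit Arguments.
Unset Strict Implicit.
Unset Printing Implicit Defensive.

Record sgraph := SGraph {
  vertex :> finType;
  adj : rel vertex;
  adj_sym : symmetric adj;
  adj_irr : irreflexive adj;
  vertex_gt0 : 0 < #|vertex| }.

Definition graph_iso (G H : sgraph) : Prop :=
  exists2 f : G -> H, bijective f & forall x y, adj (f x) (f y) = adj x y.

(* Classes are closed under isomorphism, as usual for graph classes. *)
Record graph_class := GraphClass {
  class_mem :> sgraph -> Prop;
  class_iso : forall G H : sgraph, graph_iso G H -> class_mem G -> class_mem H }.

Section Graph.
Variable G : sgraph.
Implicit Type S : {set G}.

Section Induced.
Variables (S : {set G}) (S0 : S != set0).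

Definition induced_adj : rel {x : G | x \in S} :=
  fun x y => adj (val x) (val y).

Lemma induced_adj_sym : symmetric induced_adj.
Proof. by move=> x y; apply: adj_sym. Qed.

Lemma induced_adj_irr : irreflexive induced_adj.
Proof. by move=> x; apply: adj_irr. Qed.

Lemma induced_vertex_gt0 : 0 < #|{: {x : G | x \in S}}|.
Proof. by rewrite card_sig card_gt0. Qed.

Definition induced : sgraph :=
  SGraph induced_adj_sym induced_adj_irr induced_vertex_gt0.

End Induced.

Definition clique S : bool :=
  [forall x in S, forall y in S, (x != y) ==> adj x y].

Definition omega : nat := \max_(S : {set G} | clique S) #|S|.

Definition adj_minus S : rel G :=
  fun x y => [&& x \notin S, y \notin S & adj x y].

Definition components_minus S : {set {set G}} :=
  equivalence_partition (connect (adj_minus S)) (~: S).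

Definition balanced_separator S : bool :=
  [forall A in components_minus S, 3 * #|A| <= 2 * #|G|].

Lemma balanced_separatorT : balanced_separator [set: G].
Proof.
apply/forall_inP => A /imsetP[x]; by rewrite setCT inE.
Qed.

(* [arg min] is meaningful here by balanced_separatorT. *)
Definition sep : nat :=
  #|[arg min_(S < [set: G] | balanced_separator S) #|S|]|.

End Graph.

Definition hereditary (C : graph_class) : Prop :=
  forall (G : sgraph) (S : {set G}) (S0 : S != set0), C G -> C (induced S0).

(* Main.v *)
Require Import Defs.
From HB Require Import structures.
From mathcomp Require Import all_boot all_order all_algebra.
From mathcomp Require Import reals exp.
From mathcomp Require Import zify.

Set Implicit Arguments.
Unset Strict Implicit.
Unset Printing Implicit Defensive.

(** The separator is built from the hypothesis for two values of q: q = 2, and a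
constant that depends on the degree of an expander.  The clique number of the
given graph enters the bound in a single place.

The case q = 2 bounds the induced bicliques of the class: K_{t,t} has clique
number 2, while each of its balanced cuts has at least 2t/3 vertices, so
K_{t,t} is excluded for some t that depends on the class alone
([sublinear_cuts_biclique_free]).  Now let G be in the class, with n vertices
and clique number w.  A neighbourhood of size (2w)^t m contains at least m^t
independent t-tuples ([many_indep_tuples]), whereas an independent t-tuple has
fewer than (2w)^t common neighbours, since these would otherwise contain an
independent t-set and hence complete an induced K_{t,t}.  Double counting shows
that few vertices have degree (2w)^t m or more, even when m is only slightly
smaller than n ([few_high_degree]).  The set X of these vertices goes into the
separator.  The factor w^t of the theorem arises here; the remaining
argument is uniform in w.

Suppose that every balanced cut of G is larger than a budget of order
w^t n / a, where a is a small power of n.  Fix a graph F of maximum degree d on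
k vertices in which any two sets of k/8 vertices are joined by an edge
([bounded_degree_expander]).  Then F can be found in G as an induced minor:
there are pairwise disjoint connected branch sets of at most b vertices, b of
order a log n, joined by an edge of G exactly when the corresponding vertices
of F are adjacent ([induced_expander_model]).  The construction is greedy.  It
keeps a remainder R of more than 2n/3 vertices and

- cuts off a part of R whose neighbourhood in R is at most a fraction 1/a
  of the part, paying for it by adding this neighbourhood to the separator;
- forgets a branch set that has lost its private access to R;
- otherwise adds a branch set for a further vertex of F.  It is made of short
  geodesics of the expanding set R, all starting at one vertex, which lead to
  private neighbours of the at most d adjacent branch sets.

The closed neighbourhoods of the branch sets, the set X and the paid vertices
are together within the budget, so they never separate G in a balanced way, and
R stays large.  Forgetting branch sets makes backtracking harmless, because R
shrinks in each of the other two steps.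

Geodesics contain no triangle and F has degree at most d, so the subgraph
induced by the model has clique number at most q = (d+1)(3d+1), a constant
([model_clique]).  The hypothesis for this q cuts that subgraph, and its
heavier parts again and again, with about (kb)^{1-eta} vertices each time; after
O(log n) rounds nothing is left, and the accumulated separator has at most
k/16 vertices.  The expansion of F does not allow this, since one side always
retains at least k/8 whole branch sets ([model_cuts_absurd]).  It suffices that
k is a large enough power of a, which is compatible with the budget when a is a
small enough power of n ([sep_nat_bound]).

Exponents are handled over the natural numbers: a bound s <= c n^{1-1/e} is
written s^e <= c' n^{e-1}. *)

(** * Balanced separators and balanced cuts *)

Definition anticomplete (G : sgraph) (A B : {set G}) : Prop :=
  forall x y, x \in A -> y \in B -> ~~ adj x y.

(** Grouping the components of [U] minus [S] into two sides turns a balanced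
    separator into a partition, which can be checked without connectivity. *)
Definition balanced_cut (G : sgraph) (U S A B : {set G}) : Prop :=
  [/\ U = S :|: A :|: B, [disjoint A & B], anticomplete A B,
      3 * #|A| <= 2 * #|U| & 3 * #|B| <= 2 * #|U|].

Lemma sep_le (G : sgraph) (S A B : {set G}) :
  balanced_cut [set: G] S A B -> sep G <= #|S|.
Proof.
case=> eU _ antiAB leA leB; rewrite cardsT in leA leB.
suff balS : balanced_separator S.
  by rewrite /sep; case: arg_minnP => [|T _ minT];
     [exact: balanced_separatorT | exact: minT].
apply/forall_inP => P /imsetP[x xS ->].
have closedA (C D : {set G}) : [set: G] = S :|: C :|: D -> anticomplete C D ->
    x \in C -> [set y in ~: S | connect (adj_minus S) x y] \subset C.
  move=> eU' anti xC; apply/subsetP => y; rewrite inE => /andP[_].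
  case/connectP => p; elim: p x xC {xS} => [|z p IH] x xC /= => [_ -> //|].
  case/andP => /and3P[xS zS xz] pz ey; apply: IH pz ey.
  have := in_setT z; rewrite eU' !inE (negPf zS) /= => /orP[//|zD].
  by have := anti _ _ xC zD; rewrite xz.
have: x \in A :|: B by have := in_setT x; rewrite eU; move: xS; rewrite !inE => /negPf->.
rewrite inE => /orP[xA|xB].
  by apply: leq_trans leA; rewrite leq_mul2l /= subset_leq_card // (closedA A B).
apply: leq_trans leB; rewrite leq_mul2l /= subset_leq_card // (closedA B A) //.
  by rewrite setUAC.
by move=> y z yB zA; rewrite adj_sym antiAB.
Qed.

(** Take a union [Q] of components that is as large as possible among those with
    at most two thirds of the vertices.  If the rest is too large, then [Q] has
    less than one third, and by maximality any component outside [Q] has more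
    than one third; that component alone is then a good side. *)
Lemma balanced_separator_cut (G : sgraph) (S : {set G}) :
  balanced_separator S -> exists A B : {set G}, balanced_cut [set: G] S A B.
Proof.
move=> /forall_inP balS.
pose closed (Q : {set G}) :=
  (Q \subset ~: S) && [forall x in Q, forall y, (adj x y && (y \notin S)) ==> (y \in Q)].
have cutQ (Q : {set G}) : closed Q -> 3 * #|Q| <= 2 * #|G| ->
    3 * #|~: S :\: Q| <= 2 * #|G| -> exists A B : {set G}, balanced_cut [set: G] S A B.
  case/andP=> sQ /forall_inP cQ leQ leQ'; exists Q, (~: S :\: Q).
  split; rewrite ?cardsT //.
  - by apply/setP => x; rewrite !inE; case: (x \in S); case: (x \in Q).
  - by rewrite disjoint_sym disjoints_subset; apply/subsetP => x; rewrite !inE => /andP[].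
  move=> x y xQ; rewrite !inE => /andP[yQ yS]; apply: contra yQ => xy.
  by move/forallP/(_ y): (cQ x xQ); rewrite xy yS.
pose comp x := [set y in ~: S | connect (adj_minus S) x y].
have compS x : x \notin S -> 3 * #|comp x| <= 2 * #|G|.
  by move=> xS; apply: balS; apply/imsetP; exists x; rewrite ?inE.
have closedU (Q : {set G}) x : closed Q -> x \notin S -> closed (Q :|: comp x).
  case/andP=> sQ /forall_inP cQ xS; apply/andP; split.
    by rewrite subUset sQ; apply/subsetP => y; rewrite !inE => /andP[].
  apply/forall_inP => y yU; apply/forallP => z; apply/implyP => /andP[yz zS].
  case/setUP: yU => [yQ|].
    by move/forallP/(_ z): (cQ y yQ); rewrite yz zS inE => /= ->.
  rewrite !inE => /andP[yS xy]; rewrite zS /= (connect_trans xy) ?orbT //.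
  by apply: connect1; rewrite /adj_minus yS zS.
have closed0 : closed set0.
  by rewrite /closed sub0set; apply/forall_inP => x; rewrite inE.
pose small Q := closed Q && (3 * #|Q| <= 2 * #|G|).
have small0 : small set0 by rewrite /small closed0 cards0.
case: (arg_maxnP (fun Q : {set G} => #|Q|) small0) => Q /andP[cQ leQ] maxQ.
case: (leqP (3 * #|~: S :\: Q|) (2 * #|G|)) => [|big]; first exact: cutQ.
have [x xQ] : exists x, x \in ~: S :\: Q.
  by apply/set0Pn; rewrite -card_gt0; lia.
have /andP[xQ' xS] : (x \notin Q) && (x \notin S) by move: xQ; rewrite !inE.
have cx : x \in comp x by rewrite !inE xS connect0.
have clx : closed (comp x) by rewrite -[comp x]set0U closedU.
apply: (cutQ (comp x)) => //; first exact: compS.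
have lt_Q : #|Q| < #|Q :|: comp x|.
  by apply: proper_card; rewrite properUl //; apply/subsetPn; exists x.
have bigU : 2 * #|G| < 3 * #|Q :|: comp x|.
  rewrite ltnNge; apply/negP => le; have := maxQ (Q :|: comp x).
  by rewrite /small closedU // le => /(_ isT); lia.
have QS : #|Q| + #|~: S :\: Q| <= #|G|.
  rewrite -cardsUI setDE.
  have -> : Q :&: (~: S :&: ~: Q) = set0.
    by apply/setP => y; rewrite !inE; case: (y \in Q); rewrite ?andbF.
  by rewrite cards0 addn0 max_card.
have := (leq_card_setU Q (comp x)).1.
have : #|~: S :\: comp x| + #|comp x| <= #|G|.
  rewrite addnC -cardsUI setDE.
  have -> : comp x :&: (~: S :&: ~: comp x) = set0.
    by apply/setP => y; rewrite !inE; case: (y \in S); case: (connect _ _ _); rewrite ?andbF.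
  by rewrite cards0 addn0 max_card.
move: lt_Q bigU QS big; lia.
Qed.

(** The bound on [S] is the integral form of a bound of order #|U|^(1 - 1/e). *)
Definition sublinear_cuts (G : sgraph) (q c e : nat) : Prop :=
  forall U : {set G}, U != set0 ->
  (forall Q : {set G}, clique Q -> Q \subset U -> #|Q| <= q) ->
  exists S A B : {set G}, balanced_cut U S A B /\ #|S| ^ e <= c * #|U| ^ e.-1.

Lemma balanced_cut_induced (G : sgraph) (U : {set G}) (U0 : U != set0)
    (S A B : {set induced U0}) :
  balanced_cut [set: induced U0] S A B ->
  balanced_cut U (val @: S) (val @: A) (val @: B).
Proof.
have val_inj' : injective (val : induced U0 -> G) by exact: val_inj.
case=> eT dAB anti leA leB.
have cT : #|[set: induced U0]| = #|U| by rewrite cardsT card_sig.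
split; rewrite ?card_imset -?cT //.
- apply/setP => x; apply/idP/idP => [xU|].
    have := in_setT (exist _ x xU : induced U0); rewrite eT !inE.
    by case/orP => [/orP[]|] h; rewrite (imset_f val h) ?orbT.
  by rewrite -!imsetU => /imsetP[y _ ->]; apply: (valP y).
- rewrite -setI_eq0 -(imsetI (in2W val_inj')) imset_eq0 setI_eq0 //.
by move=> x y /imsetP[x' xA ->] /imsetP[y' yB ->]; apply: (anti x' y').
Qed.

Lemma omega_induced_le (G : sgraph) (U : {set G}) (U0 : U != set0) q :
  (forall Q : {set G}, clique Q -> Q \subset U -> #|Q| <= q) ->
  omega (induced U0) <= q.
Proof.
move=> leq_q; apply/bigmax_leqP => Q /forall_inP clQ.
have val_inj' : injective (val : induced U0 -> G) by exact: val_inj.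
rewrite -(card_imset (mem Q) val_inj'); apply: leq_q.
  apply/forall_inP => _ /imsetP[x xQ ->]; apply/forall_inP => _ /imsetP[y yQ ->].
  by rewrite (inj_eq val_inj'); apply: (forall_inP (clQ x xQ)).
by apply/subsetP => _ /imsetP[x _ ->]; apply: (valP x).
Qed.

(** * Neighbourhoods and cliques *)

Lemma card_bigcup_le (T I : finType) (P : {set I}) (A : I -> {set T}) (m : nat) :
  (forall i, i \in P -> #|A i| <= m) -> #|\bigcup_(i in P) A i| <= #|P| * m.
Proof.
move=> leA; rewrite -sum_nat_const.
elim/big_ind2: _ => [|B i C j leB leC|i iP]; [by rewrite cards0 | | exact: leA].
by apply: leq_trans (leq_card_setU _ _).1 _; apply: leq_add.
Qed.

Definition nbhd (G : sgraph) (x : G) : {set G} := [set y | adj x y].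

Lemma cliqueS (G : sgraph) (Q Q' : {set G}) : Q' \subset Q -> clique Q -> clique Q'.
Proof.
move=> /subsetP sQ /forall_inP clQ; apply/forall_inP => x /sQ xQ.
by apply/forall_inP => y /sQ yQ; apply: (forall_inP (clQ x xQ)).
Qed.

Lemma clique_adj (G : sgraph) (Q : {set G}) x y :
  clique Q -> x \in Q -> y \in Q -> x != y -> adj x y.
Proof. by move=> /forall_inP clQ xQ yQ; apply/implyP/(forall_inP (clQ x xQ)). Qed.

Lemma clique_le_omega (G : sgraph) (Q : {set G}) : clique Q -> #|Q| <= omega G.
Proof. by move=> clQ; rewrite /omega (bigmax_sup Q). Qed.

Lemma omega_gt0 (G : sgraph) : 0 < omega G.
Proof.
have /card_gt0P[x _] := vertex_gt0 G; rewrite -(cards1 x); apply: clique_le_omega.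
apply/forall_inP => y /set1P ->; apply/forall_inP => z /set1P ->; by rewrite eqxx.
Qed.

(** * Few vertices of large degree *)

(** Distinctness is included so that independent tuples have distinct entries. *)
Definition nonadj (G : sgraph) (x y : G) : bool := (x != y) && ~~ adj x y.

Definition indep_tuples (G : sgraph) (t : nat) (U : {set G}) : {set t.-tuple G} :=
  [set s : t.-tuple G | pairwise (@nonadj G) s && all (mem U) s].

(** Induced K_{t,t} as a pair of independent sets, complete to each other; the two
    sides are then automatically disjoint. *)
Definition biclique_free (G : sgraph) (t : nat) : Prop :=
  forall P Q : {set G}, #|P| = t -> #|Q| = t ->
    anticomplete P P -> anticomplete Q Q ->
    exists x y, [/\ x \in P, y \in Q & ~~ adj x y].

Lemma clique_independent (G : sgraph) (Q P : {set G}) :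
  clique Q -> anticomplete P P -> #|Q :&: P| <= 1.
Proof.
move=> clQ indP; apply/card_le1_eqP => x y; rewrite !inE.
move=> /andP[yQ yP] /andP[xQ xP]; apply/eqP/negPn/negP => /(clique_adj clQ xQ yQ).
by rewrite (negPf (indP _ _ xP yP)).
Qed.

(** A cut of K_{t,t} with both sides nonempty has them inside one colour class, so
    it contains the whole other class.  Hence every balanced cut has at least a
    third of the 2t vertices, which exceeds the assumed bound. *)
Lemma sublinear_cuts_biclique_free (G : sgraph) (c e t : nat) :
  0 < e -> 3 ^ e * c < 2 * t -> sublinear_cuts G 2 c e -> biclique_free G t.
Proof.
move=> e0 lt_t cuts P Q cP cQ indP indQ.
case: (altP (@forall_inP _ (mem P) (fun x => [forall y in Q, adj x y]))); last first.
  rewrite negb_forall_in => /exists_inP[x xP]; rewrite negb_forall_in.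
  by case/exists_inP => y yQ nxy; exists x, y.
move=> complPQ; exfalso.
have full x y : x \in P -> y \in Q -> adj x y.
  by move=> xP yQ; apply: (forall_inP (complPQ x xP)).
have PQ0 : P :&: Q = set0.
  by apply/setP => x; rewrite !inE; apply/negP => /andP[xP xQ];
     have := full x x xP xQ; rewrite adj_irr.
have cU : #|P :|: Q| = 2 * t by rewrite cardsU PQ0 cards0 cP cQ; lia.
have U0 : P :|: Q != set0 by rewrite -card_gt0 cU; lia.
have [|S [A [B [[eU dAB antiAB leA leB] leS]]]] := cuts (P :|: Q) U0.
  move=> K clK /setIidPl eK; rewrite -eK setIUr.
  rewrite (leq_trans (leq_card_setU _ _).1) // (@leq_add _ _ 1 1) //;
    exact: clique_independent.
have bigS : 2 * t <= 3 * #|S|.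
  rewrite leqNgt; apply/negP => ltS.
  have leU : 2 * t <= #|S| + #|A| + #|B|.
    rewrite -cU eU (leq_trans (leq_card_setU _ _).1) // leq_add2r.
    exact: (leq_card_setU _ _).1.
  have [x xA] : exists x, x \in A by apply/set0Pn; rewrite -card_gt0; lia.
  have [y yB] : exists y, y \in B by apply/set0Pn; rewrite -card_gt0; lia.
  have sub z : z \in A :|: B -> z \in P :|: Q.
    by move=> zAB; rewrite eU -setUA inE zAB orbT.
  (* vertices on opposite sides of the cut are not adjacent, hence in one class *)
  have same u v : u \in A -> v \in B -> (u \in P) = (v \in P).
    move=> uA vB.
    have := sub u; have := sub v; rewrite !inE uA vB orbT => /(_ isT) v' /(_ isT) u'.
    have := antiAB _ _ uA vB.
    have := @full u v; have := @full v u; rewrite [adj v u]adj_sym.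
    case: (u \in P) (u \in Q) (v \in P) (v \in Q) u' v' => [] [] [] [] //= _ _.
    - by move=> _ /(_ isT isT) ->.
    - by move=> _ /(_ isT isT) ->.
    - by move=> /(_ isT isT) ->.
    - by move=> /(_ isT isT) ->.
  have sideS (K L : {set G}) : #|L| = t -> P :|: Q = K :|: L ->
      (forall z, z \in A :|: B -> z \notin L) -> False.
    move=> cL eKL noL; have : #|L| <= #|S|; last by lia.
    apply/subset_leq_card/subsetP => z zL.
    have : z \in P :|: Q by rewrite eKL inE zL orbT.
    by rewrite eU -setUA !inE; case/orP => // zAB; have := noL z; rewrite inE zAB zL => /(_ isT).
  case xP: (x \in P).
    apply: (sideS P Q) => // z zAB; apply/negP => zQ.
    suff zP : z \in P by have := in_set0 z; rewrite -PQ0 inE zP zQ.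
    case/setUP: zAB => [zA|zB]; last by rewrite -(same x z).
    by rewrite (same z y) // -(same x y).
  apply: (sideS Q P) => //; first exact: setUC.
  move=> z zAB; apply/negP => zP.
  case/setUP: zAB => [zA|zB]; last by rewrite -(same x z) // xP in zP.
  by rewrite (same z y) // -(same x y) // xP in zP.
move: leS; rewrite cU => leS.
have : (2 * t) ^ e <= 3 ^ e * c * (2 * t) ^ e.-1.
  rewrite -mulnA (leq_trans _ (leq_mul (leqnn _) leS)) // -expnMn leq_exp2r //.
rewrite -{1}(prednK e0) expnS leq_pmul2r ?expn_gt0; last by apply/orP; left; lia.
by rewrite leqNgt lt_t.
Qed.

(** Let [Q] be a maximal clique among the vertices with fewer than [a]
    non-neighbours.  By maximality every such vertex is a non-neighbour of some
    member of [Q], or in [Q]; so there are at most [w * a] of them. *)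
Lemma many_sparse_vertices (G : sgraph) (w a m : nat) (U : {set G}) :
  0 < w -> 0 < m -> (forall Q : {set G}, clique Q -> Q \subset U -> #|Q| <= w) ->
  m + w * a <= #|U| ->
  m <= #|[set x in U | a <= #|U :\: (x |: nbhd x)|]|.
Proof.
move=> w0 m0 clU leU; set Gd := [set x in U | _].
rewrite leqNgt; apply/negP => ltm.
pose isclq (Q : {set G}) := clique Q && (Q \subset U :\: Gd).
have c0 : isclq set0 by rewrite /isclq sub0set andbT; apply/forall_inP => x; rewrite inE.
case: (arg_maxnP (fun Q : {set G} => #|Q|) c0) => Q /andP[clQ sQ] maxQ.
have leQ : #|Q| <= w by apply: clU => //; apply: subset_trans sQ (subsetDl _ _).
have cover : U :\: Gd \subset \bigcup_(x in Q) (U :\: nbhd x).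
  apply/subsetP => y yB; have yU : y \in U by case/setDP: yB.
  apply/bigcupP; case yQ: (y \in Q); first by exists y; rewrite // !inE adj_irr.
  have /exists_inP[x xQ nxy] : [exists x in Q, ~~ adj x y].
    rewrite -negb_forall_in; apply/negP => /forall_inP all_adj.
    have := maxQ (y |: Q); rewrite cardsU1 yQ /isclq subUset sub1set yB sQ !andbT.
    rewrite add1n /geq /= ltnn => H; suff /H : clique (y |: Q) by [].
    apply/forall_inP => u uQ; apply/forall_inP => v vQ; apply/implyP => uv.
    case/setU1P: uQ uv => [->|uQ]; case/setU1P: vQ => [->|vQ]; rewrite ?eqxx // => uv.
    - by rewrite adj_sym all_adj.
    - exact: all_adj.
    exact: clique_adj clQ _ _ _.
  by exists x => //; rewrite !inE nxy.
have small : #|U :\: Gd| <= w * a.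
  apply: leq_trans (subset_leq_card cover) _.
  apply: leq_trans (_ : #|Q| * a <= _); last by rewrite leq_mul2r leQ orbT.
  apply: card_bigcup_le => x xQ; have /setDP[xU] := subsetP sQ x xQ.
  rewrite inE xU /= -ltnNge.
  have -> : U :\: nbhd x = x |: (U :\: (x |: nbhd x)).
    by apply/setP => y; rewrite !inE; case: eqP => //= ->; rewrite adj_irr xU.
  by rewrite cardsU1 !inE eqxx.
have := cardsID Gd U; have -> : U :&: Gd = Gd by apply/setIidPr/subsetP => x; rewrite inE => /andP[].
lia.
Qed.

(** A Ramsey statement with multiplicities: choose the entries one after the other,
    each among the many vertices that keep a fraction 1/(2w) of the current set
    available.  The bound is polynomial in [w], since it is [t], the size of the
    independent set, that is fixed. *)
Lemma many_indep_tuples (G : sgraph) (w m t : nat) (U : {set G}) :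
  0 < w -> 0 < m -> (forall Q : {set G}, clique Q -> Q \subset U -> #|Q| <= w) ->
  (2 * w) ^ t * m <= #|U| -> m ^ t <= #|indep_tuples t U|.
Proof.
move=> w0 m0; elim: t U => [|t IH] U clU leU.
  rewrite expn0 card_gt0; apply/set0Pn; exists [tuple]; by rewrite inE.
pose Gd := [set x in U | (2 * w) ^ t * m <= #|U :\: (x |: nbhd x)|].
have leGd : m <= #|Gd|.
  apply: (@many_sparse_vertices _ w) => //; apply: leq_trans leU.
  rewrite expnS; have : 0 < (2 * w) ^ t by rewrite expn_gt0 muln_gt0 w0.
  move: (_ ^ _) => y y0; rewrite -!mulnA mul2n -addnn leq_add2r mulnA.
  by rewrite leq_pmull // muln_gt0 w0.
pose D := [set p : G * t.-tuple G |
  (p.1 \in Gd) && (p.2 \in indep_tuples t (U :\: (p.1 |: nbhd p.1)))].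
have cD : #|D| = \sum_(x in Gd) #|indep_tuples t (U :\: (x |: nbhd x))|.
  transitivity (\sum_(x in Gd) \sum_(s in indep_tuples t (U :\: (x |: nbhd x))) 1).
    by rewrite pair_big_dep /= -sum1_card; apply: eq_bigl => p; rewrite inE.
  by apply: eq_bigr => x _; rewrite sum1_card.
have inj_cons : injective (fun p : G * t.-tuple G => [tuple of p.1 :: p.2]).
  by move=> [x s] [y r] /(congr1 val) /= [-> /val_inj ->].
apply: leq_trans (_ : #|D| <= _).
  rewrite cD expnS; apply: leq_trans (_ : #|Gd| * m ^ t <= _); first by rewrite leq_mul2r leGd orbT.
  rewrite -sum_nat_const; apply: leq_sum => x; rewrite inE => /andP[xU le_x].
  apply: IH le_x => Q clQ sQ; apply: clU clQ _; exact: subset_trans sQ (subsetDl _ _).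
rewrite -(card_imset (mem D) inj_cons); apply/subset_leq_card/subsetP => _ /imsetP[[x s] + ->].
rewrite !inE /= => /andP[/andP[xU _] /andP[-> /allP als]]; rewrite xU !andbT /=.
apply/andP; split; last by apply/allP => y /als; rewrite !inE => /andP[].
by apply/allP => y /als; rewrite !inE negb_or /nonadj [x == y]eq_sym => /andP[].
Qed.

Lemma indep_tuple_set (G : sgraph) (t : nat) (U : {set G}) (s : t.-tuple G) :
  s \in indep_tuples t U ->
  [/\ #|[set x in s]| = t, [set x in s] \subset U & anticomplete [set x in s] [set x in s]].
Proof.
rewrite inE => /andP[pw /allP als].
have us : uniq s by rewrite uniq_pairwise; apply: sub_pairwise pw => x y /andP[].
split; first by rewrite cardsE (card_uniqP us) size_tuple.
  by apply/subsetP => x; rewrite inE; apply: als.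
move=> x y; rewrite !inE => xs ys; case: (eqVneq x y) => [->|xy]; first by rewrite adj_irr.
suff nonadj_pair: forall r : seq G, pairwise (@nonadj G) r ->
    x \in r -> y \in r -> ~~ adj x y by exact: nonadj_pair pw xs ys.
elim=> [|z r IH] /=; first by rewrite in_nil.
case/andP => /allP zr pwr.
rewrite !inE => /predU1P[ex|xr] /predU1P[ey|yr]; last exact: IH.
- by rewrite ex ey eqxx in xy.
- by rewrite ex; case/andP: (zr _ yr).
- by rewrite ey adj_sym; case/andP: (zr _ xr).
Qed.

(** Double counting of the pairs formed by a vertex of large degree and an
    independent t-tuple in its neighbourhood. *)
Lemma few_high_degree (G : sgraph) (w m t : nat) :
  0 < w -> 0 < m -> omega G <= w -> biclique_free G t ->
  #|[set x : G | (2 * w) ^ t * m <= #|nbhd x|]| * m ^ t <= (2 * w) ^ t * #|G| ^ t.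
Proof.
move=> w0 m0 lew bf; set X := [set x | _].
have clw (U Q : {set G}) : clique Q -> Q \subset U -> #|Q| <= w.
  by move=> clQ _; apply: leq_trans lew; apply: clique_le_omega.
apply: leq_trans (_ : \sum_(x in X) #|indep_tuples t (nbhd x)| <= _).
  rewrite -sum_nat_const; apply: leq_sum => x; rewrite inE => le_x.
  by apply: (@many_indep_tuples _ w) le_x => // Q; apply: clw.
have -> : \sum_(x in X) #|indep_tuples t (nbhd x)| =
    \sum_(s : t.-tuple G) #|[set x in X | s \in indep_tuples t (nbhd x)]|.
  under eq_bigr => x _ do rewrite -sum1_card big_mkcond.
  rewrite exchange_big; apply: eq_bigr => s _.
  rewrite -big_mkcondr -sum1_card; apply: eq_bigl => x; by rewrite !inE.
rewrite mulnC -card_tuple -sum_nat_const; apply: leq_sum => s _.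
set Y := [set x in X | _]; rewrite leqNgt; apply/negP => ltY.
have [x0 /setIdP[_ x0s]] : exists x, x \in Y by apply/set0Pn; rewrite -card_gt0; lia.
have : 1 ^ t <= #|indep_tuples t Y|.
  by apply: (@many_indep_tuples _ w) => // [Q|]; [apply: clw | rewrite muln1 ltnW].
rewrite exp1n card_gt0 => /set0Pn[s' s'Y].
have [cs _ is_] := indep_tuple_set x0s; have [cs' sub' is'] := indep_tuple_set s'Y.
have [y [x [ys xs nyx]]] := bf _ _ cs cs' is_ is'.
have := subsetP sub' x xs; rewrite inE => /andP[_ /indep_tuple_set[_ /subsetP/(_ y ys) + _]].
by rewrite inE adj_sym (negPf nyx).
Qed.

(** * Expanders of bounded degree *)

(** (1 + 1/n)^n >= 2, by the Bernoulli inequality. *)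
Lemma double_expn_le (n : nat) : 0 < n -> 2 * n ^ n <= n.+1 ^ n.
Proof.
move=> n0; have -> : 2 * n ^ n = n ^ n + n * n ^ n.-1.
  by rewrite -expnS prednK // mul2n addnn.
have bern m : n ^ m + m * n ^ m.-1 <= n.+1 ^ m.
  elim: m => [|m IH] /=; first by rewrite mul0n addn0.
  rewrite [n.+1 ^ _]expnS (leq_trans _ (leq_mul (leqnn _) IH)) //.
  case: m {IH} => [|m] /=; first by rewrite !expn0 expn1; lia.
  rewrite !expnS; move: (n ^ m) => y; nia.
exact: bern.
Qed.

(** Some point lies in at least the fraction 1/(p+1) of the members of [F]; picking
    such points one by one shrinks the family geometrically. *)
Lemma greedy_hitting_set (T : finType) (p m : nat) (F : {set {set T}}) :
  0 < #|T| -> (forall A, A \in F -> #|T| <= p.+1 * #|A|) ->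
  #|F| * p ^ m < p.+1 ^ m ->
  exists2 E : {set T}, #|E| <= m & forall A, A \in F -> exists2 x, x \in A & x \in E.
Proof.
move=> T0; elim: m F => [|m IH] F bigF ltF.
  rewrite !expn0 muln1 ltnS leqn0 cards_eq0 in ltF.
  by exists set0; rewrite ?cards0 // => A; rewrite (eqP ltF) inE.
have [x lex] : exists x, #|F| <= p.+1 * #|[set A in F | x \in A]|.
  apply/existsP; apply: contraT; rewrite negb_exists => /forallP lt.
  have swap : \sum_(A in F) p.+1 * #|A| = \sum_x p.+1 * #|[set A in F | x \in A]|.
    rewrite -!big_distrr; congr (_ * _).
    under eq_bigr => A _ do rewrite -sum1_card big_mkcond.
    rewrite exchange_big; apply: eq_bigr => x _.
    by rewrite -big_mkcondr -sum1_card; apply: eq_bigl => A; rewrite !inE.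
  have lo : #|F| * #|T| <= \sum_(A in F) p.+1 * #|A|.
    by rewrite -sum_nat_const; apply: leq_sum.
  have : \sum_x (p.+1 * #|[set A in F | x \in A]|).+1 <= \sum_(x : T) #|F|.
    by apply: leq_sum => x _; rewrite ltnNge.
  under eq_bigr => x _ do rewrite -addn1.
  rewrite big_split /= -swap sum1_card sum_nat_const [#|_| * _]mulnC => hi.
  by have := leq_trans hi lo; rewrite leqNgt -{1}[X in X < _]addn0 ltn_add2l T0.
pose F' := F :\: [set A in F | x \in A].
have cF' : p.+1 * #|F'| <= p * #|F|.
  have := cardsID [set A in F | x \in A] F.
  have -> : F :&: [set A in F | x \in A] = [set A in F | x \in A].
    by apply/setIidPr/subsetP => A; rewrite inE => /andP[].
  rewrite -/F'; move: lex; move: #|F'| #|F| #|[set A in F | x \in A]|; nia.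
have [A AF'|| E leE hitE] := IH F'.
- by apply: bigF; case/setDP: AF'.
- have : p.+1 * (#|F'| * p ^ m) < p.+1 * p.+1 ^ m; last by rewrite ltn_pmul2l.
  rewrite -expnS mulnA (leq_ltn_trans _ ltF) // expnS mulnA [#|F| * p]mulnC.
  by rewrite leq_mul2r cF' orbT.
exists (x |: E) => [|A AF].
  by rewrite (leq_trans (leq_card_setU _ _).1) // cards1 add1n.
case xA: (x \in A); first by exists x => //; rewrite !inE eqxx.
have [|y yA yE] := hitE A; last by exists y => //; rewrite inE yE orbT.
by rewrite !inE AF xA.
Qed.

(** Logarithmically many greedy steps exhaust a family of 4^k sets: this is linear
    in [k], which gives the expander bounded average degree. *)
Lemma four_expn_lt (p k : nat) : 0 < p -> 0 < k ->
  4 ^ k * p ^ (p * 3 * k) < p.+1 ^ (p * 3 * k).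
Proof.
move=> p0 k0; rewrite !(expnM _ (p * 3)) -expnMn ltn_exp2r // !(expnM _ p).
have := double_expn_le p0; have : 0 < p ^ p by rewrite expn_gt0 p0.
move: (p ^ p) (p.+1 ^ p) => x y x0 le_xy.
apply: (@leq_trans ((2 * x) ^ 3)); last by rewrite leq_exp2r.
by rewrite expnMn ltn_pmul2r // expn_gt0 x0.
Qed.

Lemma sum_degrees (I : finType) (E : {set I * I}) :
  \sum_f #|[set g | ((f, g) \in E) || ((g, f) \in E)]| <= 2 * #|E|.
Proof.
have out : \sum_f #|[set g | (f, g) \in E]| = #|E|.
  under eq_bigr => f _ do rewrite -sum1_card big_mkcond.
  rewrite pair_bigA -sum1_card [RHS]big_mkcond; apply: eq_bigr => -[f g] _ /=.
  by rewrite inE.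
have inn : \sum_f #|[set g | (g, f) \in E]| = #|E|.
  under eq_bigr => f _ do rewrite -sum1_card big_mkcond.
  rewrite exchange_big pair_bigA -sum1_card [RHS]big_mkcond.
  by apply: eq_bigr => -[f g] _ /=; rewrite inE.
rewrite mul2n -addnn -{1}out -inn -big_split; apply: leq_sum => f _.
apply: leq_trans (leq_card_setU _ _).1; apply/subset_leq_card/subsetP => g.
by rewrite !inE.
Qed.

(** The vertices outside [V] are those of too large degree; they are left out rather
    than removed, to stay in ['I_k].  At most k/16 are lost, which the constants
    k/8 can absorb. *)
Definition has_expanders (d : nat) : Prop := forall k, 0 < k ->
  exists (V : {set 'I_k}) (e : rel 'I_k), [/\ symmetric e, 15 * k <= 16 * #|V|,
    forall f, f \in V -> #|[set g | e f g]| <= d &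
    forall A B : {set 'I_k}, k <= 8 * #|A| -> k <= 8 * #|B| ->
      exists f g, [/\ f \in A, g \in B & e f g]].

(** The edges form a set hitting all the products of two sets of k/8 vertices. *)
Lemma bounded_degree_expander : exists d, has_expanders d.
Proof.
(* a product of two sets of k/8 vertices fills 1/64 of all pairs, so p + 1 = 64 *)
have [C [C0 ltC]] : exists C, 0 < C /\
    forall k, 0 < k -> 4 ^ k * 63 ^ (C * k) < 64 ^ (C * k).
  by exists (63 * 3); split => // k k0; apply: four_expn_lt.
exists (32 * C) => k k0.
pose F := [set setX p.1 p.2 | p in
  [set p : {set 'I_k} * {set 'I_k} | (k <= 8 * #|p.1|) && (k <= 8 * #|p.2|)]].
have cF : #|F| <= 4 ^ k.
  apply: (leq_trans (leq_imset_card _ _)); apply: (leq_trans (max_card _)).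
  by rewrite card_prod -!cardsT -powersetT card_powerset cardsT card_ord -expnMn.
have [|P /imsetP[[A B]]||E leE hitE] := @greedy_hitting_set _ 63 (C * k) F.
- by rewrite card_prod card_ord muln_gt0 k0.
- rewrite inE /= => /andP[leA leB] ->; rewrite cardsX card_prod card_ord.
  by apply: leq_trans (leq_mul leA leB) _; rewrite mulnACA.
- by apply: leq_ltn_trans (ltC k k0); rewrite leq_mul2r cF orbT.
pose e f g := ((f, g) \in E) || ((g, f) \in E).
pose V := [set f : 'I_k | #|[set g | e f g]| <= 32 * C].
exists V, e; split.
- by move=> f g; rewrite /e orbC.
- have few : 16 * #|~: V| <= k.
    have : #|~: V| * (32 * C) <= 2 * #|E|.
      apply: leq_trans (sum_degrees E); rewrite -sum_nat_const.
      rewrite [leqRHS](bigID (mem (~: V))) /=.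
      apply: leq_trans (leq_addr _ _); apply: leq_sum => f.
      by rewrite !inE -ltnNge => /ltnW.
    move=> le_deg; rewrite -(@leq_pmul2l (2 * C)) ?muln_gt0 ?C0 //.
    have -> : 2 * C * (16 * #|~: V|) = #|~: V| * (32 * C) by rewrite mulnACA [RHS]mulnC -[RHS]mulnA.
    by rewrite (leq_trans le_deg) // -mulnA leq_mul2l leE.
  by move: few (cardsC V); rewrite card_ord; move: #|V| #|~: V|; lia.
- by move=> f; rewrite inE.
move=> A B leA leB; have [|[f g]] := hitE (setX A B).
  by apply: (imset_f (fun p => setX p.1 p.2) (x := (A, B))); rewrite inE leA.
by rewrite inE /= => /andP[fA gB] fgE; exists f, g; rewrite /e fgE.
Qed.

(** * Geodesics in expanding sets *)

Definition cnbhd (G : sgraph) (T : {set G}) : {set G} :=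
  \bigcup_(x in T) (x |: nbhd x).

Section ClosedNeighbourhood.
Variable G : sgraph.
Implicit Types (x y : G) (S T : {set G}).

Lemma cnbhdP T y :
  reflect (exists2 x, x \in T & (y == x) || adj x y) (y \in cnbhd T).
Proof.
by apply: (iffP bigcupP) => -[x xT xy]; exists x => //; move: xy; rewrite !inE.
Qed.

Lemma mem_cnbhd T x y : x \in T -> adj x y -> y \in cnbhd T.
Proof. by move=> xT xy; apply/cnbhdP; exists x; rewrite // xy orbT. Qed.

Lemma sub_cnbhd T : T \subset cnbhd T.
Proof. by apply/subsetP => x xT; apply/cnbhdP; exists x; rewrite // eqxx. Qed.

Lemma cnbhdS S T : S \subset T -> cnbhd S \subset cnbhd T.
Proof.
move/subsetP => sST; apply/subsetP => y /cnbhdP[x xS xy].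
by apply/cnbhdP; exists x => //; apply: sST.
Qed.

Lemma card_cnbhd_le T m :
  (forall x, x \in T -> #|nbhd x| < m) -> #|cnbhd T| <= #|T| * m.
Proof.
move=> ltm; apply: card_bigcup_le => x xT.
by rewrite cardsU1 inE adj_irr ltm.
Qed.

(** Connectivity is stated by closure, as an induction principle along the edges of
    the subgraph induced by [P]. *)
Definition connected_from (P : {set G}) (r : G) : Prop :=
  forall Q : {set G}, (forall x y, x \in P -> y \in P -> x \in Q -> adj x y -> y \in Q) ->
    r \in Q -> P \subset Q.

Definition connected_set (P : {set G}) : Prop := forall r, r \in P -> connected_from P r.

Lemma connected_from_set (P : {set G}) r :
  r \in P -> connected_from P r -> connected_set P.
Proof.
move=> rP conP s sP Q clQ sQ; apply: (conP) => //; apply: contraT => rQ.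
have /subsetP/(_ s sP) : P \subset ~: Q; last by rewrite inE sQ.
apply: conP; last by rewrite inE.
move=> x y xP yP; rewrite !inE => xQ xy; apply: contra xQ => yQ.
by apply: clQ yQ _ => //; rewrite adj_sym.
Qed.

End ClosedNeighbourhood.

Section ExpandingSet.
Variables (G : sgraph) (R : {set G}) (a : nat).
Hypothesis a_gt0 : 0 < a.
Hypothesis expanding : forall A : {set G}, A \subset R -> A != set0 ->
  2 * #|A| <= #|R| -> #|A| < a * #|(R :&: cnbhd A) :\: A|.

Fixpoint ball (r : G) (i : nat) : {set G} :=
  if i is i'.+1 then R :&: cnbhd (ball r i') else [set r].

Lemma ball_sub r i : r \in R -> ball r i \subset R.
Proof. by case: i => [|i] rR /=; [rewrite sub1set | apply: subsetIl]. Qed.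

Lemma ball_S r i : r \in R -> ball r i \subset ball r i.+1.
Proof. by move=> rR; rewrite subsetI ball_sub // sub_cnbhd. Qed.

Lemma ball_mono r i j : r \in R -> i <= j -> ball r i \subset ball r j.
Proof.
move=> rR /subnKC <-; elim: (j - i) => [|k IH]; first by rewrite addn0.
by rewrite addnS; apply: subset_trans IH (ball_S _ rR).
Qed.

Lemma ball_center r i : r \in R -> r \in ball r i.
Proof. by move=> rR; apply: (subsetP (ball_mono rR (leq0n i))); rewrite inE. Qed.

Lemma ball_cat r s y i j : r \in R -> s \in R ->
  y \in ball s j -> y \in ball r i -> s \in ball r (i + j).
Proof.
move=> rR sR; elim: j y i => [|j IH] y i /=.
  by rewrite inE addn0 => /eqP ->.
rewrite inE => /andP[yR /cnbhdP[z zs yz]] yr; rewrite addnS -addSn.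
have zR := subsetP (ball_sub j sR) z zs.
apply: IH zs _; rewrite inE zR /=.
by apply/cnbhdP; exists y; rewrite // eq_sym adj_sym.
Qed.

(** As long as a ball has at most half of [R], the next one is larger by a factor
    1 + 1/a. *)
Lemma ball_growth r i : r \in R ->
  #|R| < 2 * #|ball r i| \/ a.+1 ^ i <= a ^ i * #|ball r i|.
Proof.
move=> rR; elim: i => [|i [IH|IH]]; first by right; rewrite cards1.
  by left; apply: leq_trans IH _; rewrite leq_mul2l subset_leq_card ?ball_S.
case: (ltnP #|R| (2 * #|ball r i|)) => [lt|le].
  by left; apply: leq_trans lt _; rewrite leq_mul2l subset_leq_card ?ball_S.
right; have := expanding (ball_sub i rR) _ le.
have -> : ball r i != set0 by apply/set0Pn; exists r; apply: ball_center.
move/(_ isT); have := cardsID (ball r i) (ball r i.+1).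
have -> : ball r i.+1 :&: ball r i = ball r i by apply/setIidPr/ball_S.
rewrite /= => <- lt; rewrite !expnS.
have : a.+1 * #|ball r i| <= a * (#|ball r i| + #|R :&: cnbhd (ball r i) :\: ball r i|).
  by rewrite mulSn addnC mulnDr leq_add2l ltnW.
move: (#|_| + #|_|) => y le_y; rewrite mulnAC.
apply: leq_trans (leq_mul (leqnn _) IH) _; rewrite mulnCA mulnC.
by rewrite leq_mul2r le_y orbT.
Qed.

Lemma ball_large r L : r \in R -> #|G| < 2 ^ L -> #|R| < 2 * #|ball r (a * L)|.
Proof.
move=> rR ltL; case: (ball_growth (a * L) rR) => // le.
suff : 2 ^ L <= #|ball r (a * L)|.
  by move=> le'; have := leq_ltn_trans (leq_trans le' (max_card _)) ltL; rewrite ltnn.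
rewrite -(@leq_pmul2l (a ^ (a * L))) ?expn_gt0 ?a_gt0 //.
apply: leq_trans le; rewrite mulnC !expnM -expnMn.
by have [->|L0] := posnP L; rewrite ?leqnn // leq_exp2r // double_expn_le.
Qed.

(** Both balls of radius [a * L] contain more than half of [R], so they meet. *)
Lemma ball_all r y L : r \in R -> y \in R -> #|G| < 2 ^ L ->
  y \in ball r (2 * a * L).
Proof.
move=> rR yR ltL.
have /set0Pn[z] : ball r (a * L) :&: ball y (a * L) != set0.
  rewrite -card_gt0 cardsI subn_gt0 //.
  apply: (@leq_ltn_trans #|R|).
    by apply/subset_leq_card; rewrite subUset !ball_sub.
  by have := ball_large rR ltL; have := ball_large yR ltL; lia.
rewrite inE => /andP[zr zy]; rewrite -mulnA mul2n -addnn.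
exact: ball_cat zy zr.
Qed.

(** The vertices of a shortest path.  Each of them, except the first, has only its
    predecessor as a neighbour among the earlier ones, so a clique has at most two
    vertices.  The induction is on the exact distance; its last clause, that all
    the other vertices are strictly closer to [r], is what rules out a further
    neighbour of the new endpoint. *)
Lemma geodesic_set r y l : r \in R -> y \in ball r l ->
  exists P : {set G}, [/\ [/\ P \subset R, r \in P & y \in P], #|P| <= l.+1,
    connected_from P r &
    forall Q : {set G}, clique Q -> Q \subset P -> #|Q| <= 2].
Proof.
move=> rR; suff exact_dist i : forall y, y \in ball r i ->
    (0 < i -> y \notin ball r i.-1) ->
    exists P : {set G}, [/\ [/\ P \subset R, r \in P & y \in P], #|P| <= i.+1,
      connected_from P r,
      forall Q : {set G}, clique Q -> Q \subset P -> #|Q| <= 2 &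
      forall z, z \in P -> z != y -> 0 < i /\ z \in ball r i.-1].
  move=> yl; have ex_i : exists i, y \in ball r i by exists l.
  case: (ex_minnP ex_i) => i yi min_i; have il := min_i _ yl.
  have [|P [PR cP conP clP _]] := exact_dist i y yi.
    by move=> i0; apply/negP => /min_i; rewrite leqNgt prednK ?leqnn.
  by exists P; split => //; apply: leq_trans cP _.
elim: i => [|i IH] {}y /=.
  rewrite inE => /eqP -> _; exists [set r]; split.
  - by rewrite sub1set !inE eqxx.
  - by rewrite cards1.
  - by move=> Q _ rQ; rewrite sub1set.
  - by move=> Q _ sQ; apply: leq_trans (subset_leq_card sQ) _; rewrite cards1.
  - by move=> z; rewrite inE => ->.
move=> /[dup] yi1; rewrite inE => /andP[yR /cnbhdP[z zi zy]] /(_ isT) yi.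
have {}zy : adj z y by case/orP: zy => // /eqP yz; rewrite yz zi in yi.
have [|P [[PR rP zP] cP conP clP layP]] := IH z zi.
  case: i {IH} zi yi yi1 => //= i zi yi yi1 _; apply/negP => zi'.
  by move/negP: yi; apply; rewrite inE yR (mem_cnbhd zi' zy).
have Pi u : u \in P -> u \in ball r i.
  move=> uP; case: (eqVneq u z) => [->//|/(layP _ uP)[i0 ui]].
  by rewrite -(prednK i0); apply: (subsetP (ball_S _ rR)).
exists (y |: P); split.
- by rewrite subUset sub1set yR PR !inE eqxx rP orbT.
- by rewrite cardsU1 -add1n leq_add // leq_b1.
- move=> Q clQ rQ; have PQ : P \subset Q.
    by apply: (conP) => // u v uP vP uQ uv; apply: clQ uv; rewrite // !inE ?uP ?vP orbT.
  rewrite subUset sub1set PQ andbT; apply: (clQ z) => //; rewrite ?inE ?eqxx ?zP ?orbT //.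
  exact: (subsetP PQ).
- move=> Q clQ sQ; case yQ: (y \in Q); last first.
    apply: clP => //; apply/subsetP => u uQ.
    by have := subsetP sQ u uQ => /setU1P[eu|//]; rewrite -eu uQ in yQ.
  apply: leq_trans (_ : #|[set y; z]| <= 2); last by rewrite cards2; case: (y != z).
  apply/subset_leq_card/subsetP => u uQ; rewrite !inE; apply: contraT.
  rewrite negb_or => /andP[uy uz].
  have uP : u \in P by have := subsetP sQ u uQ => /setU1P[/eqP|//]; rewrite (negPf uy).
  have [i0 ui] := layP u uP uz.
  have uyadj := clique_adj clQ uQ yQ uy.
  move/negP: yi; case; rewrite -(prednK i0) /= inE yR.
  exact: mem_cnbhd ui uyadj.
by move=> u /setU1P[->|uP]; rewrite ?eqxx // => uy; split => //; apply: Pi.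
Qed.

End ExpandingSet.

(** * Embedding a sparse graph as an induced minor *)

Record branch_set (G : sgraph) (b w : nat) (P : {set G}) : Prop := BranchSet {
  branch_neq0 : P != set0;
  branch_connected : connected_set P;
  branch_card : #|P| <= b;
  branch_clique : forall Q : {set G}, clique Q -> Q \subset P -> #|Q| <= w }.

(** Here [r] is the body, [P j] is a leg, and [x j] is the vertex outside of the
    remainder in which the leg ends. *)
Definition spider (G : sgraph) (I : finType) (K : {set I}) (r : G) (x : I -> G)
    (P : I -> {set G}) : {set G} := r |: \bigcup_(j in K) (x j |: P j).

(** A clique takes at most two vertices from each leg, which is a geodesic, one
    tip from each leg, and the centre. *)
Lemma spider_branch_set (G : sgraph) (I : finType) (d l : nat) (K : {set I})
    (r : G) (x : I -> G) (P : I -> {set G}) :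
  #|K| <= d ->
  (forall j, j \in K -> [/\ connected_from (P j) r, #|P j| <= l,
     forall Q : {set G}, clique Q -> Q \subset P j -> #|Q| <= 2 &
     exists2 y, y \in P j & adj y (x j)]) ->
  branch_set (d * l.+1).+1 (3 * d).+1 (spider K r x P).
Proof.
move=> cK legs; have rA : r \in spider K r x P by apply: setU11.
have legA j : j \in K -> x j |: P j \subset spider K r x P.
  by move=> jK; apply: subsetU; rewrite (bigcup_sup j) ?orbT.
split.
- by apply/set0Pn; exists r.
- apply: (connected_from_set rA) => Q clQ rQ; apply/subsetP => u.
  case/setU1P => [->//|/bigcupP[j jK]].
  have [conP _ _ [y yP yx]] := legs j jK.
  have inA z : z \in x j |: P j -> z \in spider K r x P by apply: (subsetP (legA j jK)).
  have /subsetP PQ : P j \subset Q.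
    by apply: conP => // z z' zP zP' zQ; apply: clQ zQ; apply: inA; rewrite setU1r.
  case/setU1P => [->|]; last exact: PQ.
  by apply: (clQ y) => //; [apply: inA; rewrite setU1r | apply: inA; apply: setU11 | apply: PQ].
- rewrite -[(d * _).+1]add1n; apply: leq_trans (leq_card_setU _ _).1 _.
  rewrite cards1 leq_add2l; apply: leq_trans (_ : #|K| * l.+1 <= _); last by rewrite leq_mul2r cK orbT.
  apply: card_bigcup_le => j /legs[_ cP _ _].
  by apply: leq_trans (leq_card_setU _ _).1 _; rewrite cards1 add1n.
move=> Q clQ sQ; have -> : Q = Q :&: spider K r x P by apply/esym/setIidPl.
rewrite setIUr big_distrr /= -[(3 * d).+1]add1n; apply: leq_trans (leq_card_setU _ _).1 _.
apply: leq_add; first by rewrite -(cards1 r); apply/subset_leq_card/subsetIr.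
apply: leq_trans (_ : #|K| * 3 <= _); last by rewrite mulnC leq_mul2l cK orbT.
apply: card_bigcup_le => j /legs[_ _ clP _].
rewrite setIUr; apply: leq_trans (leq_card_setU _ _).1 _; rewrite (@leq_add _ _ 1 2) //.
  by rewrite -(cards1 (x j)); apply/subset_leq_card/subsetIr.
by apply: clP (subsetIr _ _); apply: cliqueS clQ; apply: subsetIl.
Qed.

(** An induced minor model of the graph [e] restricted to [J]. *)
Record induced_model (G : sgraph) (I : finType) (e : rel I) (b w : nat)
    (J : {set I}) (B : I -> {set G}) : Prop := InducedModel {
  model_branch : forall f, f \in J -> branch_set b w (B f);
  model_disjoint : forall f g, f \in J -> g \in J -> f != g -> [disjoint B f & B g];
  model_adj : forall f g, f \in J -> g \in J -> f != g -> e f g ->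
    exists x y, [/\ x \in B f, y \in B g & adj x y];
  model_nonadj : forall f g, f \in J -> g \in J -> f != g -> ~~ e f g ->
    anticomplete (B f) (B g) }.

Section Embedding.
Variables (G : sgraph) (I : finType) (V : {set I}) (e : rel I) (d a L D : nat).
Variable X : {set G}.
Hypothesis e_sym : symmetric e.
Hypothesis e_deg : forall f, f \in V -> #|[set g | e f g]| <= d.
Hypothesis a_gt0 : 0 < a.
Hypothesis G_lt : #|G| < 2 ^ L.
Hypothesis X_deg : forall x, x \notin X -> #|nbhd x| < D.

Let b := (d * (2 * a * L).+2).+1.
Let w := (3 * d).+1.

Hypothesis no_cut : forall S A B : {set G}, balanced_cut [set: G] S A B ->
  #|G| %/ a + #|X| + #|I| * (b * D) < #|S|.

Definition branch_union (J : {set I}) (B : I -> {set G}) : {set G} := \bigcup_(f in J) B f.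

(** [J] is the set of embedded vertices of the sparse graph, [R] is the remainder,
    and [Z] collects the vertices paid for cutting parts off the remainder.  By
    [state_boundary], the vertices outside [R], [X], [Z] and the closed
    neighbourhood of the model are separated from [R].  By [state_Z], each paid
    vertex corresponds to [a] vertices that have left [R]. *)
Record state (J : {set I}) (B : I -> {set G}) (R Z : {set G}) : Prop := State {
  state_sub : J \subset V;
  state_model : induced_model e b w J B;
  state_X : forall f, f \in J -> [disjoint B f & X];
  state_R : [disjoint R & X :|: cnbhd (branch_union J B)];
  state_boundary : forall x y, x \in R -> adj x y ->
    y \in R :|: X :|: Z :|: cnbhd (branch_union J B);
  state_Z : a * #|Z| + #|R| <= #|G|;
  state_large : 2 * #|G| < 3 * #|R| }.

Lemma sub_branch_union (J : {set I}) (B : I -> {set G}) f : f \in J -> B f \subset branch_union J B.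
Proof. by move=> fJ; apply: bigcup_sup. Qed.

(** The separator between [R] and the discarded vertices is within the budget, so it
    is not balanced and one of the two has more than 2n/3 vertices.  It cannot be
    the discarded side, because that side avoids [R0]; in each step, [R0] is the
    part of the previous remainder that was not cut off. *)
Lemma remainder_large J B (R Z R0 : {set G}) :
  induced_model e b w J B -> (forall f, f \in J -> [disjoint B f & X]) ->
  (forall x y, x \in R -> adj x y -> y \in R :|: X :|: Z :|: cnbhd (branch_union J B)) ->
  a * #|Z| + #|R| <= #|G| ->
  #|G| <= 3 * #|R0| -> R0 \subset R :|: X :|: Z :|: cnbhd (branch_union J B) ->
  2 * #|G| < 3 * #|R|.
Proof.
move=> mB BX boundary leZ leR0 sR0; rewrite ltnNge; apply/negP => leR.
pose S := X :|: Z :|: cnbhd (branch_union J B); pose E := ~: (R :|: S).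
have RS : R :|: X :|: Z :|: cnbhd (branch_union J B) = R :|: S by rewrite /S !setUA.
have cut : balanced_cut [set: G] S E R.
  split; rewrite ?cardsT //.
  - apply/setP => x; rewrite in_setT !(in_setU, in_setC).
    by case: (x \in R) (x \in X) (x \in Z) (x \in cnbhd _) => [] [] [] [].
  - by rewrite disjoint_sym disjoints_subset setCK subsetUl.
  - move=> x y; rewrite inE => xE yR; apply: contra xE; rewrite adj_sym => yx.
    by rewrite -RS; apply: boundary yR yx.
  have : #|E| + #|R0| <= #|G|.
    rewrite -cardsUI (_ : E :&: R0 = set0) ?cards0 ?addn0 ?max_card //.
    apply/setP => x; rewrite inE in_set0 inE -RS; apply/negP => /andP[nx /(subsetP sR0)].
    by rewrite (negPf nx).
  by move: leR0; lia.
have := no_cut cut; rewrite ltnNge => /negP[].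
have leT : #|branch_union J B| <= #|I| * b.
  apply: leq_trans (_ : #|J| * b <= _); last by rewrite leq_mul2r max_card orbT.
  by apply: card_bigcup_le => f fJ; apply: branch_card (model_branch mB fJ).
have leN : #|cnbhd (branch_union J B)| <= #|I| * (b * D).
  rewrite mulnA; apply: leq_trans (_ : #|branch_union J B| * D <= _); last by rewrite leq_mul2r leT orbT.
  apply: card_cnbhd_le => x /bigcupP[f fJ xf]; apply: X_deg.
  by rewrite (disjointFr (BX f fJ)).
have leZ' : #|Z| <= #|G| %/ a by rewrite leq_divRL // mulnC; apply: leq_trans (leq_addr _ _) leZ.
apply: leq_trans (leq_card_setU _ _).1 _; apply: leq_add leN.
by apply: leq_trans (leq_card_setU _ _).1 _; rewrite addnC leq_add2r.
Qed.

(** [A] is at most half of [R] and violates expansion. *)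
Definition splits (R A : {set G}) : bool :=
  [&& A \subset R, A != set0, 2 * #|A| <= #|R| &
      a * #|(R :&: cnbhd A) :\: A| <= #|A|].

Lemma split_step J B R Z A : state J B R Z -> splits R A ->
  exists R' Z' : {set G}, state J B R' Z' /\ #|R'| < #|R|.
Proof.
case=> sJ mB BX dR bd leZ bigR /and4P[sA A0 halfA leN].
pose N := (R :&: cnbhd A) :\: A; pose R' := R :\: cnbhd A; pose Z' := Z :|: N.
have RA : R :\: A \subset R' :|: N.
  by apply/subsetP => x; rewrite !inE => /andP[-> ->]; case: (x \in cnbhd A).
have A_R' : #|A| + #|R'| <= #|R|.
  rewrite -cardsUI (_ : A :&: R' = set0) ?cards0 ?addn0.
    by rewrite subset_leq_card // subUset sA subsetDl.
  apply/setP => x; rewrite !inE; apply/negP => /and3P[xA xN _].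
  by rewrite (subsetP (sub_cnbhd A) x xA) in xN.
have bd' x y : x \in R' -> adj x y ->
    y \in R' :|: X :|: Z' :|: cnbhd (branch_union J B).
  move=> /setDP[xR xA] xy; have := bd x y xR xy; rewrite /R' /Z' /N.
  have yA : y \notin A by apply: contra xA => yA; rewrite (mem_cnbhd yA) // adj_sym.
  rewrite !inE yA; case: (y \in cnbhd A); case: (y \in cnbhd (branch_union J B));
    by case: (y \in R); case: (y \in X); case: (y \in Z).
have leZ' : a * #|Z'| + #|R'| <= #|G|.
  apply: leq_trans leZ; apply: leq_trans (_ : a * #|Z| + (#|A| + #|R'|) <= _); last first.
    by rewrite leq_add2l.
  rewrite addnA leq_add2r; apply: leq_trans (_ : a * #|Z| + a * #|N| <= _); last by rewrite leq_add2l.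
  by rewrite -mulnDr leq_mul2l (leq_card_setU _ _).1 orbT.
exists R', Z'; split; last first.
  by apply: leq_trans A_R'; rewrite -add1n leq_add2r card_gt0.
split=> //.
- by apply: disjointWl dR; apply: subsetDl.
apply: (remainder_large mB BX bd' leZ' (R0 := R :\: A)).
  by have := cardsID A R; rewrite (setIidPr sA); lia.
apply: subset_trans RA _; apply/subsetP => x; rewrite /Z' !inE -!orbA.
by case/orP => [->|->]; rewrite ?orbT.
Qed.

(** [p.1] is a private neighbour of the branch set of [j], usable for the next
    connection, and [p.2] is a vertex of [R] through which it is reached. *)
Definition alive (J : {set I}) (B : I -> {set G}) (R : {set G}) (j : I)
    (p : G * G) : bool :=
  [&& p.1 \notin X, p.1 \notin B j, [exists z in B j, adj z p.1],
      [forall g in J, (g != j) ==> (p.1 \notin cnbhd (B g))],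
      p.2 \in R & adj p.1 p.2].

Lemma cnbhd_branch_union (J : {set I}) (B : I -> {set G}) x :
  reflect (exists2 f, f \in J & x \in cnbhd (B f)) (x \in cnbhd (branch_union J B)).
Proof.
apply: (iffP idP) => [/cnbhdP[y /bigcupP[f fJ yf] xy]|[f fJ]].
  by exists f => //; apply/cnbhdP; exists y.
by apply: (subsetP (cnbhdS (sub_branch_union B fJ))).
Qed.

(** The remainder is unchanged.  A neighbour of [R] near the discarded branch set and
    no other one would make that branch set alive, unless it is in [X]. *)
Lemma discard_step J B R Z j : state J B R Z -> j \in J ->
  ~~ [exists p, alive J B R j p] -> state (J :\ j) B R Z.
Proof.
case=> sJ mB BX dR bd leZ bigR jJ /existsPn dead.
have sJ' : J :\ j \subset J by apply: subsetDl.
have sT : branch_union (J :\ j) B \subset branch_union J B.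
  by apply/bigcupsP => f /(subsetP sJ') fJ; apply: sub_branch_union.
split=> //.
- exact: subset_trans sJ' sJ.
- case: mB => m1 m2 m3 m4; have inJ := subsetP sJ'.
  by split=> [f /inJ|f g /inJ fJ /inJ|f g /inJ fJ /inJ|f g /inJ fJ /inJ]; auto.
- by move=> f /(subsetP sJ'); apply: BX.
- by apply: disjointWr dR; apply: setUS; apply: cnbhdS.
move=> x y xR xy; have := bd x y xR xy; rewrite !inE.
case/orP => [->//|/cnbhd_branch_union[f fJ yf]].
case yT: (y \in cnbhd (branch_union (J :\ j) B)); first by rewrite orbT.
have yg g : g \in J -> g != j -> y \notin cnbhd (B g).
  move=> gJ gj; apply: contraFN yT => yg.
  by apply/cnbhd_branch_union; exists g; rewrite // !inE gj.
have ej : f = j by apply/eqP; apply: contraT => /(yg f fJ); rewrite yf.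
rewrite {f fJ}ej in yf; have yj : y \notin B j.
  apply/negP => yj; have := disjointFr dR xR; rewrite inE => /negbT; rewrite negb_or.
  case/andP=> _ /negP[]; apply/cnbhd_branch_union; exists j => //.
  by rewrite (mem_cnbhd yj) // adj_sym.
have := dead (y, x); rewrite /alive /= yj xR [adj y x]adj_sym xy !andbT.
have -> : [exists z in B j, adj z y].
  case/cnbhdP: yf => z zj /predU1P[ez|zy]; last by apply/exists_inP; exists z.
  by rewrite ez zj in yj.
have -> : [forall g in J, (g != j) ==> (y \notin cnbhd (B g))].
  by apply/forall_inP => g gJ; apply/implyP; apply: yg.
by rewrite /= ?andbT negbK => ->; rewrite orbT.
Qed.

(** The private neighbours are adjacent to exactly one branch set each, and the
    remainder is adjacent to none; therefore the new branch set touches exactly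
    the branch sets that it should. *)
Lemma embed_step J B R Z f : state J B R Z -> (forall A, ~~ splits R A) ->
  (forall j, j \in J -> [exists p, alive J B R j p]) -> f \in V -> f \notin J ->
  exists B' R', state (f |: J) B' R' Z /\ #|R'| < #|R|.
Proof.
case=> sJ mB BX dR bd leZ bigR nosplit alv fV fJ.
have expanding (A : {set G}) : A \subset R -> A != set0 -> 2 * #|A| <= #|R| ->
    #|A| < a * #|(R :&: cnbhd A) :\: A|.
  by move=> sA A0 leA; have := nosplit A; rewrite /splits sA A0 leA /= ltnNge.
have [r rR] : exists r, r \in R by apply/set0Pn; rewrite -card_gt0; move: bigR; lia.
have RX x : x \in R -> x \notin X.
  by move=> xR; have := disjointFr dR xR; rewrite inE => /negbT; rewrite negb_or => /andP[].
have RN x g : x \in R -> g \in J -> x \notin cnbhd (B g).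
  move=> xR gJ; have := disjointFr dR xR; rewrite inE => /negbT; rewrite negb_or.
  by case/andP=> _; apply: contra => xg; apply/cnbhd_branch_union; exists g.
have [p pP] : exists p : I -> G * G, forall j, j \in J -> alive J B R j (p j).
  apply: (fin_all_exists (P := fun j q => j \in J -> alive J B R j q)) => j.
  case jJ: (j \in J); last by exists (r, r).
  by have /existsP[q Hq] := alv j jJ; exists q.
have [P PP] : exists P : I -> {set G}, forall j, j \in J ->
    [/\ [/\ P j \subset R, r \in P j & (p j).2 \in P j], #|P j| <= (2 * a * L).+1,
      connected_from (P j) r &
      forall Q : {set G}, clique Q -> Q \subset P j -> #|Q| <= 2].
  apply: (fin_all_exists (P := fun (j : I) (P : {set G}) => j \in J -> [/\ [/\ P \subset R, r \in P & (p j).2 \in P],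
    #|P| <= (2 * a * L).+1, connected_from P r &
      forall Q : {set G}, clique Q -> Q \subset P -> #|Q| <= 2])) => j.
  case jJ: (j \in J); last by exists set0.
  have /and5P[_ _ _ _ /andP[yR _]] := pP j jJ.
  have [P HP] := geodesic_set rR (ball_all a_gt0 expanding rR yR G_lt).
  by exists P.
pose K := [set j in J | e f j].
have cK : #|K| <= d.
  apply: leq_trans (e_deg fV); apply/subset_leq_card/subsetP => j.
  by rewrite !inE => /andP[].
pose tip j := (p j).1; pose A := spider K r tip P.
have rA : r \in A by apply: setU11.
have AP u : u \in A -> u \in R \/ exists j, [/\ j \in J, e f j & u = tip j].
  case/setU1P => [->|/bigcupP[j]]; first by left.
  rewrite inE => /andP[jJ fj] /setU1P[->|uP]; first by right; exists j.
  by left; have [[/subsetP sP _ _] _ _ _] := PP j jJ; apply: sP.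
have brA : branch_set b w A.
  apply: spider_branch_set cK _ => j; rewrite inE => /andP[jJ _].
  have [[_ rP yP] cP conP clP] := PP j jJ; have /and5P[_ _ _ _ /andP[_ xy]] := pP j jJ.
  by split=> //; exists (p j).2; rewrite // adj_sym.
have AX : [disjoint A & X].
  rewrite disjoints_subset; apply/subsetP => u /AP[/RX|[j [jJ _ ->]]]; first by rewrite inE.
  by have /and5P[] := pP j jJ; rewrite inE.
have AB g : g \in J -> [disjoint A & B g].
  move=> gJ; rewrite disjoints_subset; apply/subsetP => u /AP[uR|[j [jJ _ ->]]]; rewrite inE.
    by apply: contra (RN u g uR gJ); apply: (subsetP (sub_cnbhd _)).
  have /and5P[_ xj _ /forall_inP /(_ g gJ) far _] := pP j jJ.
  case: (eqVneq g j) far => [->//|_ /=].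
  by apply: contra; apply: (subsetP (sub_cnbhd _)).
have A_adj g : g \in J -> e f g -> exists x y, [/\ x \in A, y \in B g & adj x y].
  move=> gJ fg; have /and5P[_ _ /exists_inP[z zB zx] _ _] := pP g gJ.
  exists (tip g), z; split; rewrite // 1?adj_sym //; apply/setU1P; right.
  by apply/bigcupP; exists g; rewrite ?setU11 // inE gJ.
have A_anti g : g \in J -> ~~ e f g -> anticomplete A (B g).
  move=> gJ fg u v uA vB; rewrite adj_sym; apply/negP => vu.
  have uN : u \in cnbhd (B g) by apply: mem_cnbhd vB vu.
  case/AP: uA => [uR|[j [jJ fj eu]]]; first by rewrite (negPf (RN u g uR gJ)) in uN.
  have /and5P[_ _ _ /forall_inP /(_ g gJ) + _] := pP j jJ.
  by rewrite -/(tip j) -eu uN implybF negbK => /eqP egj; rewrite egj fj in fg.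
pose B' g := if g == f then A else B g.
have B'f : B' f = A by rewrite /B' eqxx.
have B'J g : g \in J -> B' g = B g.
  by move=> gJ; rewrite /B'; case: eqP => // egf; rewrite -egf gJ in fJ.
have sup : branch_union (f |: J) B' = A :|: branch_union J B.
  rewrite /branch_union bigcup_setU big_set1 B'f; congr (_ :|: _).
  by apply: eq_bigr => g /B'J.
have mB' : induced_model e b w (f |: J) B'.
  case: mB => m1 m2 m3 m4; split.
  - by move=> g /setU1P[->|gJ]; rewrite ?B'f // B'J //; apply: m1.
  - move=> g h /setU1P[->|gJ] /setU1P[->|hJ]; rewrite ?eqxx // ?B'f ?B'J //.
    + by move=> _; apply: AB.
    + by move=> _; rewrite disjoint_sym; apply: AB.
    + exact: m2.
  - move=> g h /setU1P[->|gJ] /setU1P[->|hJ]; rewrite ?eqxx // ?B'f ?B'J // => gh.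
    + exact: A_adj.
    + rewrite e_sym => /(A_adj g gJ)[x [y [xA' yB xy]]].
      by exists y, x; split; rewrite // adj_sym.
    + exact: m3.
  move=> g h /setU1P[->|gJ] /setU1P[->|hJ]; rewrite ?eqxx // ?B'f ?B'J // => gh.
  - exact: A_anti.
  - rewrite e_sym => /(A_anti g gJ) anti x y xB yA; rewrite adj_sym; exact: anti.
  - exact: m4.
pose R' := R :\: cnbhd A.
have BX' g : g \in f |: J -> [disjoint B' g & X].
  by case/setU1P => [->|gJ]; rewrite ?B'f // B'J //; apply: BX.
have subN : R :|: X :|: Z :|: cnbhd (branch_union J B) \subset
            R' :|: X :|: Z :|: cnbhd (branch_union (f |: J) B').
  rewrite sup; apply/subsetP => x; rewrite !inE.
  case xA': (x \in cnbhd A).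
    by rewrite (subsetP (cnbhdS (subsetUl A _)) x xA') !orbT.
  case/orP => [->//|xT]; by rewrite (subsetP (cnbhdS (subsetUr A _)) x xT) !orbT.
have bd' x y : x \in R' -> adj x y ->
    y \in R' :|: X :|: Z :|: cnbhd (branch_union (f |: J) B').
  by case/setDP=> xR _ xy; apply: (subsetP subN); apply: bd xR xy.
have leR' : #|R'| <= #|R| by apply/subset_leq_card/subsetDl.
have leZ' : a * #|Z| + #|R'| <= #|G| by apply: leq_trans leZ; rewrite leq_add2l.
exists B', R'; split; last first.
  apply: proper_card; rewrite properE subsetDl; apply/subsetPn; exists r => //.
  by rewrite inE (subsetP (sub_cnbhd A)).
split=> //.
- by rewrite subUset sub1set fV.
- rewrite disjoints_subset; apply/subsetP => x /setDP[xR xA'].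
  rewrite !inE negb_or (RX x xR) /=; apply/cnbhd_branch_union => -[g /setU1P[->|gJ]].
    by rewrite B'f (negPf xA').
  by rewrite B'J // (negPf (RN x g xR gJ)).
apply: (remainder_large mB' BX' bd' leZ' (R0 := R)); first by move: bigR; lia.
apply: subset_trans subN; apply/subsetP => x xR; by rewrite !inE xR.
Qed.

(** Termination: the pair (#|R|, #|J|) decreases lexicographically, since discarding
    keeps [R] and the other two steps shrink it. *)
Lemma state_complete J B R Z : state J B R Z -> exists B' : I -> {set G}, induced_model e b w V B'.
Proof.
have [m] := ubnP (#|R| * #|I|.+1 + #|J|).
elim: m => // m IH in J B R Z *; rewrite ltnS => le_m st.
have smaller J' (R' : {set G}) : #|R'| < #|R| -> #|R'| * #|I|.+1 + #|J' : {set I}| < m.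
  move=> ltR; apply: leq_trans le_m; apply: (@leq_trans (#|R'|.+1 * #|I|.+1)).
    by rewrite mulSn addnC ltn_add2r ltnS max_card.
  by apply: leq_trans (leq_addr _ _); rewrite leq_mul2r ltR orbT.
case: (boolP [exists A, splits R A]) => [/existsP[A spA]|].
  have [R' [Z' [st' ltR]]] := split_step st spA.
  by apply: IH st'; apply: smaller.
rewrite negb_exists => /forallP nosplit.
case: (boolP [forall j in J, exists p, alive J B R j p]) => [/forall_inP alv|].
  have sJ := state_sub st; case: (boolP (V \subset J)) => [sV|/subsetPn[f fV fJ]].
    have eJ : J = V by apply/eqP; rewrite eqEsubset sJ.
    by exists B; rewrite -eJ; apply: state_model st.
  have [B' [R' [st' ltR]]] := embed_step st nosplit alv fV fJ.
  by apply: IH st'; apply: smaller.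
rewrite negb_forall_in => /exists_inP[j jJ dead].
apply: IH (discard_step st jJ dead); apply: leq_trans le_m.
by rewrite [#|J|](cardsD1 j) jJ addnCA add1n ltnS leqnn.
Qed.

Lemma induced_expander_model : exists B : I -> {set G}, induced_model e b w V B.
Proof.
have sup0 : branch_union set0 (fun=> set0) = set0 by rewrite /branch_union big_set0.
have N0 : cnbhd set0 = set0 :> {set G} by rewrite /cnbhd big_set0.
have bd0 x y : x \in ~: X -> adj x y ->
    y \in ~: X :|: X :|: set0 :|: cnbhd (branch_union set0 (fun=> set0)).
  by move=> _ _; rewrite !inE orNb.
have m0 : induced_model e b w set0 (fun=> set0 : {set G}).
  by split=> [f|f g|f g|f g]; rewrite inE.
have X0 f : f \in (set0 : {set I}) -> [disjoint (set0 : {set G}) & X] by rewrite inE.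
have leZ0 : a * #|set0 : {set G}| + #|~: X| <= #|G|.
  by rewrite cards0 muln0 add0n max_card.
apply: (@state_complete set0 (fun=> set0) (~: X) set0); split => //.
- exact: sub0set.
- by rewrite sup0 N0 setU0 disjoints_subset.
(* initially nothing has been discarded, and R0 can be the whole vertex set *)
apply: (remainder_large m0 X0 bd0 leZ0 (R0 := [set: G])); first by rewrite cardsT leq_pmull.
by apply/subsetP => x _; rewrite !inE orNb.
Qed.

End Embedding.

(** * Models of expanders have no small separators *)

Section ModelCuts.
Variables (G : sgraph) (k d b w : nat) (V : {set 'I_k}) (e : rel 'I_k).
Variable B : 'I_k -> {set G}.
Hypothesis k_gt0 : 0 < k.
Hypothesis e_deg : forall f, f \in V -> #|[set g | e f g]| <= d.
Hypothesis V_large : 15 * k <= 16 * #|V|.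
Hypothesis e_expander : forall P Q : {set 'I_k}, k <= 8 * #|P| -> k <= 8 * #|Q| ->
  exists f g, [/\ f \in P, g \in Q & e f g].
Hypothesis mB : induced_model e b w V B.

Let W := branch_union V B.

Lemma branch_union_card : #|W| <= k * b.
Proof.
apply: leq_trans (_ : #|V| * b <= _); last first.
  by rewrite leq_mul2r -[X in _ <= X]card_ord max_card orbT.
by apply: card_bigcup_le => f fV; apply: branch_card (model_branch mB fV).
Qed.

Lemma branch_inj f g x : f \in V -> g \in V -> x \in B f -> x \in B g -> f = g.
Proof.
move=> fV gV xf xg; apply/eqP; apply: contraT => fg.
by have := disjointFr (model_disjoint mB fV gV fg) xf; rewrite xg.
Qed.

(** The branch sets met by a clique are pairwise equal or adjacent in the sparse graph,
    hence at most [d + 1] in number. *)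
Lemma model_clique (Q : {set G}) : clique Q -> Q \subset W -> #|Q| <= d.+1 * w.
Proof.
move=> clQ /subsetP sQ; have [->|[x0 x0Q]] := set_0Vmem Q; first by rewrite cards0.
have /bigcupP[f0 f0V xf0] := sQ x0 x0Q.
pose K := [set f in V | f \in f0 |: [set g | e f0 g]].
have cK : #|K| <= d.+1.
  apply: leq_trans (_ : #|f0 |: [set g | e f0 g]| <= _).
    by apply/subset_leq_card/subsetP => f; rewrite inE => /andP[].
  by apply: leq_trans (leq_card_setU _ _).1 _; rewrite cards1 add1n ltnS e_deg.
apply: leq_trans (_ : #|K| * w <= _); last by rewrite leq_mul2r cK orbT.
apply: leq_trans (_ : #|\bigcup_(f in K) (Q :&: B f)| <= _).
  apply/subset_leq_card/subsetP => x xQ; have /bigcupP[f fV xf] := sQ x xQ.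
  apply/bigcupP; exists f; last by rewrite inE xQ.
  rewrite !inE fV /=; case: (eqVneq f f0) => //= ff0; apply: contraT => nadj.
  rewrite eq_sym in ff0; have := model_nonadj mB f0V fV ff0 nadj xf0 xf.
  rewrite (clique_adj clQ) //; apply: contra ff0 => /eqP ex.
  by rewrite (branch_inj f0V fV xf0) ?eqxx // ex.
apply: card_bigcup_le => f; rewrite inE => /andP[fV _].
apply: branch_clique (model_branch mB fV) _ _ (subsetIr _ _).
by apply: cliqueS clQ; apply: subsetIl.
Qed.

Definition inside (P : {set G}) : {set 'I_k} := [set f in V | B f \subset P].

Lemma inside_union (P Q : {set G}) : anticomplete P Q -> [disjoint P & Q] ->
  #|inside (P :|: Q)| <= #|inside P| + #|inside Q|.
Proof.
move=> anti dis; apply: leq_trans (leq_card_setU _ _).1.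
apply/subset_leq_card/subsetP => f; rewrite !inE => /andP[fV /subsetP sf]; rewrite fV /=.
have br := model_branch mB fV; have /set0Pn[x xf] := branch_neq0 br.
have := sf x xf; rewrite inE => /orP[xP|xQ]; apply/orP; [left|right].
  apply: (branch_connected br xf) xP => y z yf zf yP yz.
  by have := sf z zf; rewrite inE => /orP[//|zQ]; have := anti y z yP zQ; rewrite yz.
apply: (branch_connected br xf) xQ => y z yf zf yQ yz.
have := sf z zf; rewrite inE => /orP[zP|//].
by have := anti z y zP yQ; rewrite adj_sym yz.
Qed.

(** A branch set not contained in [P] meets [S], and the branch sets are disjoint. *)
Lemma inside_cover (P S : {set G}) : W = P :|: S -> #|V| <= #|inside P| + #|S|.
Proof.
move=> eW; pose M := [set f in V | B f :&: S != set0].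
have cM : #|M| <= #|S|.
  have [p pP] : exists p : 'I_k -> option G, forall f, f \in M ->
      exists x, [/\ p f = Some x, x \in B f & x \in S].
    exists (fun f => [pick x in B f :&: S]) => f; rewrite inE => /andP[fV /set0Pn[x xfS]].
    case: pickP => [y|/(_ x)]; last by rewrite xfS.
    by rewrite inE => /andP[yf yS]; exists y.
  have injp : {in M &, injective p}.
    move=> f g fM gM efg; have [x [px xf _]] := pP f fM; have [y [py yg _]] := pP g gM.
    move: px; rewrite efg py => -[exy]; rewrite exy in yg.
    by move: fM gM; rewrite !inE => /andP[fV _] /andP[gV _]; apply: branch_inj yg.
  have injS : injective (@Some G) by move=> x y [].
  rewrite -(card_in_imset injp) -(card_imset (mem S) injS).
  apply/subset_leq_card/subsetP => _ /imsetP[f fM ->].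
  by have [x [-> _ xS]] := pP f fM; apply: imset_f.
apply: leq_trans (leq_add (leqnn _) cM); apply: leq_trans (leq_card_setU _ _).1.
apply/subset_leq_card/subsetP => f fV; rewrite !inE fV /=.
case: eqVneq => [fS|]; rewrite ?orbT // orbF.
apply/subsetP => x xf; have : x \in W by apply: (subsetP (sub_branch_union B fV)).
rewrite eW inE => /orP[//|xS]; suff : x \in B f :&: S by rewrite fS inE.
by rewrite inE xf.
Qed.

Lemma inside_not_both (P Q : {set G}) : anticomplete P Q -> [disjoint P & Q] ->
  k <= 8 * #|inside P| -> 8 * #|inside Q| < k.
Proof.
move=> anti dis leP; rewrite ltnNge; apply/negP => leQ.
have [f [g [fP gQ fg]]] := e_expander leP leQ.
move: fP gQ; rewrite !inE => /andP[fV /subsetP fP] /andP[gV /subsetP gQ].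
have fneg : f != g.
  apply/eqP => efg; have /set0Pn[x xf] := branch_neq0 (model_branch mB fV).
  by have := disjointFr dis (fP x xf); rewrite gQ // -efg.
have [x [y [xf yg xy]]] := model_adj mB fV gV fneg fg.
by have := anti x y (fP x xf) (gQ y yg); rewrite xy.
Qed.

(** Cut [W], then the side holding many branch sets, and so on.  At each stage, the
    current part [U] is heavy, so expansion makes the union [O] of the parts
    discarded so far light.  If both sides of the next cut were light, then [U] and
    [O] together with the small separator could not account for all branch sets.
    So one side is heavy, and the heavy part shrinks by 2/3 in each round, which
    cannot go on for [r] rounds. *)
Lemma model_cuts_absurd (r : nat) : 2 ^ r * #|G| < 3 ^ r ->
  (forall U : {set G}, U \subset W -> U != set0 ->
    exists S A C : {set G}, balanced_cut U S A C /\ 16 * r * #|S| <= k) -> False.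
Proof.
move=> ltr cuts.
have heavy_nonempty (U : {set G}) : k <= 8 * #|inside U| -> U != set0.
  move=> leU; have : 0 < #|inside U| by lia.
  case/card_gt0P => f; rewrite inE => /andP[fV].
  by apply: contraTneq => ->; rewrite subset0 (branch_neq0 (model_branch mB fV)).
have rounds i : i <= r -> exists U O S : {set G},
    [/\ W = U :|: O :|: S, anticomplete U O /\ [disjoint U & O],
        16 * r * #|S| <= i * k, k <= 8 * #|inside U| & 3 ^ i * #|U| <= 2 ^ i * #|W|].
  elim: i => [_|i IH lti].
    exists W, set0, set0; split; rewrite ?setU0 ?cards0 ?muln0 //.
    - by split=> [x y _|]; rewrite ?inE // -setI_eq0 setI0.
    have -> : inside W = V; last by lia.
    by apply/setP => f; rewrite inE andb_idr // => fV; apply: sub_branch_union.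
  have [U [O [S [eW [anti dis] leS heavyU leU]]]] := IH (ltnW lti).
  have sUW : U \subset W by rewrite eW -setUA subsetUl.
  have [S' [A [C [[eU dAC antiAC leA leC] leS']]]] := cuts U sUW (heavy_nonempty _ heavyU).
  have sAU : A \subset U by rewrite eU setUAC subsetUr.
  have sCU : C \subset U by rewrite eU subsetUr.
  have leSS : 16 * r * #|S :|: S'| <= i.+1 * k.
    apply: leq_trans (_ : 16 * r * (#|S| + #|S'|) <= _).
      by rewrite leq_mul2l (leq_card_setU _ _).1 orbT.
    by rewrite mulnDr mulSn addnC leq_add.
  have smallSS : 16 * #|S :|: S'| <= k.
    have r0 : 0 < r by apply: leq_trans lti.
    rewrite -(leq_pmul2l r0) mulnA [r * 16]mulnC (leq_trans leSS) //.
    by rewrite leq_mul2r lti orbT.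
  have lightO := inside_not_both anti dis heavyU.
  have antiO (D : {set G}) : D \subset U -> anticomplete D O /\ [disjoint D & O].
    move=> /subsetP sD; split; first by move=> x y /sD; apply: anti.
    by apply: disjointWl dis; apply/subsetP.
  (* the two sides of the new cut play symmetric roles *)
  have side (D E : {set G}) : U = S' :|: D :|: E -> [disjoint D & E] -> anticomplete D E ->
      D \subset U -> 3 * #|D| <= 2 * #|U| -> k <= 8 * #|inside D| ->
      exists U O S : {set G},
      [/\ W = U :|: O :|: S, anticomplete U O /\ [disjoint U & O],
        16 * r * #|S| <= i.+1 * k, k <= 8 * #|inside U| & 3 ^ i.+1 * #|U| <= 2 ^ i.+1 * #|W|].
    move=> eU' dDE antiDE sDU leD heavyD; exists D, (O :|: E), (S :|: S').
    have [aDO dDO] := antiO D sDU; split=> //.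
    - rewrite eW eU'; apply/setP => x; rewrite !inE.
      by case: (x \in S); case: (x \in S'); case: (x \in D); case: (x \in E); case: (x \in O).
    - split; first by move=> x y xD; rewrite inE => /orP[]; [apply: aDO | apply: antiDE].
      by rewrite -setI_eq0 setIUr setU_eq0 !setI_eq0 ?dDO ?dDE ?dAC ?dAO.
    rewrite !expnS -!mulnA mulnCA.
    apply: leq_trans (_ : 3 ^ i * (2 * #|U|) <= _); first by rewrite leq_mul2l leD orbT.
    by rewrite mulnCA leq_mul2l leU orbT.
  case: (leqP k (8 * #|inside A|)) => [|lightA]; first exact: (side A C).
  case: (leqP k (8 * #|inside C|)) => [|lightC].
    apply: (side C A) => //; first by rewrite setUAC.
      by rewrite disjoint_sym.
    by move=> x y xC yA; rewrite adj_sym antiAC.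
  exfalso; have cover : W = (A :|: (C :|: O)) :|: (S :|: S').
    rewrite eW eU; apply/setP => x; rewrite !inE.
    by case: (x \in S); case: (x \in S'); case: (x \in A); case: (x \in C); case: (x \in O).
  have [aCO dCO] := antiO C sCU; have [aAO dAO] := antiO A sAU.
  have le1 := inside_cover cover.
  have le2 : #|inside (A :|: (C :|: O))| <= #|inside A| + #|inside (C :|: O)|.
    apply: inside_union.
      by move=> x y xA; rewrite inE => /orP[]; [apply: antiAC | apply: aAO].
    by rewrite -setI_eq0 setIUr setU_eq0 !setI_eq0 ?dDO ?dDE ?dAC ?dAO.
  have le3 := inside_union aCO dCO.
  move: le1 le2 le3 lightA lightC lightO smallSS V_large k_gt0.
  move: #|V| #|S :|: S'| #|inside _| #|inside _| #|inside _| #|inside _| #|inside _|; lia.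
have [U [O [S [_ _ _ /heavy_nonempty U0 leU]]]] := rounds r (leqnn r).
have : 3 ^ r <= 2 ^ r * #|G|.
  apply: leq_trans (_ : 3 ^ r * #|U| <= _); first by rewrite leq_pmulr // card_gt0.
  by apply: leq_trans leU _; rewrite leq_mul2l max_card orbT.
by rewrite leqNgt ltr.
Qed.

(** With 2L rounds the heavy part is exhausted, as 3^(2L) >= 2^(3L) > 2^(2L) n. *)
Lemma model_sublinear_absurd (c t L : nat) : 0 < t -> #|G| < 2 ^ L ->
  sublinear_cuts G (d.+1 * w) c t ->
  (32 * L) ^ t * c * b ^ t.-1 <= k -> False.
Proof.
move=> t0 ltL cuts lek; apply: (@model_cuts_absurd (2 * L)).
  apply: (@leq_trans (2 ^ (2 * L) * 2 ^ L)); first by rewrite ltn_pmul2l // expn_gt0.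
  rewrite !expnM -expnMn; apply: leq_trans (_ : 9 ^ L <= _) => //.
  by have [->|L0] := posnP L; rewrite ?leqnn // leq_exp2r.
move=> U sU U0.
have [|S [A [C [cutU leS]]]] := cuts U U0.
  by move=> Q clQ sQ; apply: model_clique clQ _; apply: subset_trans sQ sU.
exists S, A, C; split=> //; rewrite -(leq_exp2r _ _ t0) expnMn.
have leU : #|U| <= k * b by apply: leq_trans (subset_leq_card sU) branch_union_card.
apply: leq_trans (_ : (16 * (2 * L)) ^ t * (c * (k * b) ^ t.-1) <= _).
  rewrite leq_mul2l; apply/orP; right; apply: leq_trans leS _.
  rewrite leq_mul2l; apply/orP; right.
  by have [->|t1] := posnP t.-1; rewrite ?expn0 // leq_exp2r.
have -> : (16 * (2 * L)) ^ t * (c * (k * b) ^ t.-1) =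
    (32 * L) ^ t * c * b ^ t.-1 * k ^ t.-1.
  by rewrite [16 * _]mulnA (expnMn k) [k ^ _ * _]mulnC !mulnA.
by rewrite -[X in _ <= _ ^ X](prednK t0) expnS leq_mul2r lek orbT.
Qed.

End ModelCuts.

(** * Choice of the parameters *)

Lemma sep_le_budget (G : sgraph) (d a L c e k D : nat) :
  has_expanders d -> 0 < a -> #|G| < 2 ^ L -> 0 < e -> 0 < k ->
  sublinear_cuts G (d.+1 * (3 * d).+1) c e ->
  (32 * L) ^ e * c * (d * (2 * a * L).+2).+1 ^ e.-1 <= k ->
  sep G <= #|G| %/ a + #|[set x : G | D <= #|nbhd x|]|
           + k * ((d * (2 * a * L).+2).+1 * D).
Proof.
move=> expd a0 ltL e0 k0 cuts lek; set X := [set x | _].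
rewrite leqNgt; apply/negP => big.
have [V [r [r_sym V_large r_deg r_exp]]] := expd k k0.
have X_deg x : x \notin X -> #|nbhd x| < D by rewrite inE ltnNge.
have no_cut (S A B : {set G}) : balanced_cut [set: G] S A B ->
    #|G| %/ a + #|X| + #|'I_k| * ((d * (2 * a * L).+2).+1 * D) < #|S|.
  by move=> /sep_le leS; rewrite card_ord; apply: leq_trans big leS.
have [B mB] := induced_expander_model r_sym r_deg a0 ltL X_deg no_cut.
exact: (model_sublinear_absurd k0 r_deg V_large r_exp mB e0 ltL cuts lek).
Qed.

(** With [a] of order n^(1/Z), logarithms are at most [Z * a], so the branch sets have
    size O(a^2), and [k * b] is O(a^(3e)).  Taking [m] as [n] divided by a^(3e+1)
    makes the neighbourhood of the model smaller than w^t n / a, up to constants,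
    and the number of vertices of large degree at most (4w)^t a^((3e+1)t).  So it is
    enough that [Z] exceeds (3e+1)t. *)
Lemma sep_nat_bound (d c e t : nat) :
  has_expanders d -> 0 < c -> 0 < e ->
  exists K Z : nat, [/\ 0 < K, 0 < Z & forall (G : sgraph) (a : nat),
    biclique_free G t -> sublinear_cuts G (d.+1 * (3 * d).+1) c e ->
    0 < a -> a ^ Z <= #|G| < a.+1 ^ Z -> a * sep G <= K * omega G ^ t * #|G|].
Proof.
(* the summand y also covers t = 0 *)
move=> expd c0 e0; pose y := (3 * e).+1; pose Z := (y * t).+1 + y.
pose C1 := d * (2 * Z).+2 + 1; pose C3 := (32 * Z) ^ e * c * C1 ^ e.
exists (1 + 4 ^ t + C3 * 2 ^ t), Z; split=> // G a bf cuts a0 /andP[leZ ltZ].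
set n := #|G| in leZ ltZ *; set w := omega G.
have w0 : 0 < w := omega_gt0 G.
pose L := Z * a; pose b := (d * (2 * a * L).+2).+1.
pose k := (32 * L) ^ e * c * b ^ e.-1; pose m := n %/ a ^ y.
have L0 : 0 < L by rewrite muln_gt0 a0.
have k0 : 0 < k by rewrite !muln_gt0 !expn_gt0 c0 muln_gt0 L0.
have ay0 : 0 < a ^ y by rewrite expn_gt0 a0.
have aZn j : j <= Z -> a ^ j <= n.
  by move=> jZ; apply: leq_trans leZ; rewrite leq_pexp2l.
have m0 : 0 < m by rewrite divn_gt0 // aZn // leq_addl.
have ltL : n < 2 ^ L.
  apply: leq_trans ltZ _; rewrite /L mulnC expnM leq_exp2r // ltn_expl //.
have leb : b <= C1 * (a * a).
  have aa0 : 0 < a * a by rewrite muln_gt0 a0.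
  have eL : 2 * a * L = 2 * Z * (a * a) by rewrite /L mulnACA.
  rewrite /b /C1 eL mulnDl mul1n -[(d * _).+1]addn1; apply: leq_add => //.
  rewrite -[leqRHS]mulnA leq_mul2l; apply/orP; right.
  by rewrite -addn2 -[(2 * Z).+2]addn2 mulnDl leq_add2l leq_pmulr.
have := @sep_le_budget G d a L c e k ((2 * w) ^ t * m) expd a0 ltL e0 k0 cuts (leqnn _).
set X := [set x | _]; rewrite -/b -/n => le_sep.
have leX : a * #|X| <= 4 ^ t * w ^ t * n.
  have leX' : #|X| <= 4 ^ t * w ^ t * a ^ (y * t).
    have mt0 : 0 < m ^ t by rewrite expn_gt0 m0.
    rewrite -(leq_pmul2r mt0); apply: leq_trans (few_high_degree w0 m0 (leqnn _) bf) _.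
    have len : n <= 2 * m * a ^ y.
      apply: leq_trans (ltnW (ltn_ceil n ay0)) _; rewrite -/m leq_mul2r.
      by rewrite mul2n -addnn -addn1 leq_add2l m0 orbT.
    apply: leq_trans (_ : (2 * w) ^ t * (2 * m * a ^ y) ^ t <= _).
      by rewrite leq_mul2l; have [->|t0] := posnP t; rewrite ?orbT // leq_exp2r // len orbT.
    have assoc p q r : 2 * p * (2 * q * r) = 4 * p * r * q by lia.
    by rewrite expnM -!expnMn assoc.
  apply: leq_trans (leq_mul (leqnn a) leX') _; rewrite mulnCA leq_mul2l -expnS aZn ?orbT //.
  exact: leq_addr.
have leK : a * (k * (b * ((2 * w) ^ t * m))) <= C3 * 2 ^ t * w ^ t * n.
  have kb : k * b = (32 * L * b) ^ e * c.
    by rewrite /k -mulnA -expnSr prednK // [RHS]mulnC (expnMn (32 * L)) mulnCA mulnA.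
  have lekb : k * b <= C3 * a ^ (3 * e).
    rewrite kb /C3 [(32 * Z) ^ e * c * _]mulnAC [leqRHS]mulnAC leq_mul2r; apply/orP; right.
    rewrite expnM -!expnMn leq_exp2r //.
    have assoc p q r : 32 * (p * r) * (q * (r * r)) = 32 * p * q * r ^ 3.
      by rewrite !expnS expn0; lia.
    by rewrite -assoc leq_mul2l leb orbT.
  have lem : m * a ^ y <= n by apply: leq_trunc_div.
  have assoc p q r s u v : p * (q * s * (u * v * r)) = q * u * v * (r * (p * s)) by lia.
  rewrite [k * (b * _)]mulnA expnMn.
  apply: leq_trans (leq_mul (leqnn a) (leq_mul lekb (leqnn _))) _.
  by rewrite assoc -expnS leq_mul2l lem orbT.
have assoc p q r s : (1 + p + q) * r * s = r * s + p * r * s + q * r * s by lia.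
apply: leq_trans (leq_mul (leqnn a) le_sep) _; rewrite assoc mulnDr [a * (_ + _)]mulnDr.
apply: leq_add leK; apply: leq_add leX.
by rewrite mulnC (leq_trans (leq_trunc_div _ _)) // leq_pmull // expn_gt0 w0.
Qed.

Import Order.TTheory GRing.Theory Num.Theory.
Local Open Scope ring_scope.

(** Take [e] with 1/e <= eta and raise the inequality to the power [e]. *)
Lemma powR_bound_nat (R : realType) (c eta : R) :
  1 <= c -> 0 < eta -> eta <= 1 ->
  exists c' e : nat, [/\ (0 < c')%N, (0 < e)%N &
    forall s n : nat, (0 < n)%N -> s%:R <= c * (n%:R `^ (1 - eta)) ->
      (s ^ e <= c' * n ^ e.-1)%N].
Proof.
move=> c1 eta0 eta1.
pose e := (Num.bound eta^-1).+1; pose c' := Num.bound (c ^+ e).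
have c0 : 0 <= c by apply: le_trans c1.
have ltc' : c ^+ e < c'%:R.
  by rewrite archi_boundP ?exprn_ge0.
exists c', e; split=> //.
move=> s n n0 les; rewrite -(ler_nat R) natrM !natrX.
have e_eta : 1 <= e%:R * eta.
  rewrite -ler_pdivrMr // mul1r ltW // /e -natr1.
  rewrite (lt_le_trans (archi_boundP _)) ?invr_ge0 ?(ltW eta0) //.
  by rewrite lerDl.
have n1 : 1 <= n%:R :> R by rewrite ler1n.
apply: (le_trans (lerXn2r e _ _ les)); rewrite ?nnegrE ?ler0n ?mulr_ge0 ?powR_ge0 //.
rewrite exprMn ler_pM ?exprn_ge0 ?powR_ge0 ?(ltW ltc') //.
rewrite -!powR_mulrn ?powR_ge0 // -powRrM ler_powR //.
have -> : (e.-1)%:R = e%:R - 1 :> R by rewrite /e /= -natr1 addrK.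
by rewrite mulrBl mul1r [eta * _]mulrC lerD2l lerN2.
Qed.

Lemma class_sublinear_cuts (R : realType) (C : graph_class) (q : nat) (c eta : R) :
  hereditary C -> [/\ 1 <= c, 0 < eta, eta <= 1 &
      forall G : sgraph, C G -> (omega G <= q)%N ->
        exists S : {set G}, balanced_separator S /\
          #|S|%:R <= c * (#|G|%:R `^ (1 - eta))] ->
  exists c' e : nat, [/\ (0 < c')%N, (0 < e)%N &
    forall G : sgraph, C G -> sublinear_cuts G q c' e].
Proof.
move=> hC [c1 eta0 eta1 seps].
have [c' [e [c0 e0 bound]]] := powR_bound_nat c1 eta0 eta1.
exists c', e; split=> // G CG U U0 cliques.
have [S [balS leS]] := seps _ (hC G U U0 CG) (omega_induced_le U0 cliques).
have [A [B cutS]] := balanced_separator_cut balS.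
exists (val @: S), (val @: A), (val @: B); split; first exact: balanced_cut_induced.
have cU : #|induced U0| = #|U| by rewrite card_sig.
by rewrite card_imset -?cU; [apply: bound leS; apply: vertex_gt0 | apply: val_inj].
Qed.

Lemma nat_root (n Z : nat) : (0 < n)%N -> (0 < Z)%N ->
  exists a, (0 < a)%N && (a ^ Z <= n < a.+1 ^ Z)%N.
Proof.
move=> n0 Z0; have ex_a : exists a, (a ^ Z <= n)%N by exists 1%N; rewrite exp1n.
have ub a : (a ^ Z <= n)%N -> (a <= n)%N.
  apply: leq_trans; case: a => // a; rewrite -(prednK Z0) expnS.
  by rewrite leq_pmulr // expn_gt0.
case: (ex_maxnP ex_a ub) => a lea maxa; exists a; rewrite lea /=.
have -> : (0 < a)%N by apply: maxa; rewrite exp1n.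
by rewrite ltnNge; apply/negP => /maxa; rewrite ltnn.
Qed.

Theorem theorem4p5 (R : realType) (C : graph_class) (hC : hereditary C)
  (hsep : forall q : nat, (0 < q)%N ->
    exists c eta : R, [/\ 1 <= c, 0 < eta, eta <= 1 &
      forall G : sgraph, C G -> (omega G <= q)%N ->
        exists S : {set G}, balanced_separator S /\
          #|S|%:R <= c * (#|G|%:R `^ (1 - eta))]) :
  exists (K beta : R) (s : nat), [/\ 1 <= K, 0 < beta &
    forall G : sgraph, C G ->
      (sep G)%:R <= K * (omega G)%:R ^+ s * (#|G|%:R `^ (1 - beta))].
Proof.
have [d expd] := bounded_degree_expander.
have [c2 [eta2 /(class_sublinear_cuts hC)[b2 [e2 [b20 e20 cuts2]]]]] := hsep 2%N isT.
have [cq [etaq /(class_sublinear_cuts hC)[b [e [b0 e0 cuts]]]]] :=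
  hsep (d.+1 * (3 * d).+1)%N isT.
pose t := (3 ^ e2 * b2)%N.
have t0 : (0 < t)%N by rewrite muln_gt0 expn_gt0.
have bf G : C G -> biclique_free G t.
  by move=> CG; apply: sublinear_cuts_biclique_free e20 _ (cuts2 G CG); rewrite -/t ltn_Pmull.
have [K [Z [K0 Z0 bound]]] := sep_nat_bound t expd b0 e0.
have Z0R : 0 < Z%:R :> R by rewrite ltr0n.
exists (2 * K%:R), Z%:R^-1, t; split; last 1 first.
- move=> G CG; have [a /andP[a0 aZ]] := nat_root (vertex_gt0 G) Z0.
  have n0 : 0 < #|G|%:R :> R by rewrite ltr0n vertex_gt0.
  have a0R : 0 < a%:R :> R by rewrite ltr0n.
  have := bound G a (bf G CG) (cuts G CG) a0 aZ.
  rewrite -(ler_nat R) !natrM natrX => le_sep; rewrite -(ler_pM2l a0R).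
  apply: le_trans le_sep _.
  have root_le : #|G|%:R `^ Z%:R^-1 <= 2 * a%:R :> R.
    have -> : 2 * a%:R = ((2 * a%:R) ^+ Z) `^ Z%:R^-1 :> R.
      by rewrite -powR_mulrn ?mulr_ge0 // -powRrM divff ?gt_eqF // powRr1 ?mulr_ge0.
    apply: ge0_ler_powR; rewrite ?invr_ge0 ?nnegrE ?exprn_ge0 ?mulr_ge0 //.
    rewrite -natrM -natrX ler_nat; case/andP: aZ => _ /ltnW /leq_trans; apply.
    by rewrite leq_exp2r // mul2n -addnn -addn1 leq_add2l.
  have nE : #|G|%:R = #|G|%:R `^ Z%:R^-1 * #|G|%:R `^ (1 - Z%:R^-1) :> R.
    rewrite -powRD; last by rewrite (gt_eqF n0) implybT.
    by rewrite addrCA subrr addr0 powRr1 // ltW.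
  rewrite [X in _ * X <= _]nE !mulrA ler_wpM2r ?powR_ge0 //.
  have -> : a%:R * 2 * K%:R * (omega G)%:R ^+ t = K%:R * (omega G)%:R ^+ t * (2 * a%:R) :> R.
    by rewrite -[a%:R * 2 * _ * _]mulrA mulrC [2 * _]mulrC.
  by rewrite ler_wpM2l // mulr_ge0 // exprn_ge0.
- by rewrite -natrM ler1n muln_gt0.
by rewrite invr_gt0.
Qed.
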